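(* Let $p$ be a prime number and let $K$ be an infinite integral domain. Equip $M_p(K)$ with the canonical $\mathbb{Z}_p$-grading. Then the $\mathbb{Z}_p$-graded central polynomials of $M_p(K)$ follow from the polynomials listed below; that is, the set $C_{\mathbb{Z}_p}(M_p(K))$ of $\mathbb{Z}_p$-graded central polynomials of $M_p(K)$ is equal to the $T_{\mathbb{Z}_p}$-space of $K\langle X\rangle$ generated by the following polynomials: (8) $z_1(x_1x_2-x_2x_1)z_2$, where $\alpha(x_1)=\alpha(x_2)=\overline 0$; (9) $z_1(x_1x_2x_3-x_3x_2x_1)z_2$, where $\alpha(x_1)=-\alpha(x_2)=\alpha(x_3)\neq\overline 0$; (10) if $p=2$: $z_1^2$ and $z_1^2z_2^2$ with $z_1,z_2\in K\langle X\rangle_{\overline 1}$; if $p>2$: the monomials $x_1^p\cdots x_l^p$ with $1\le l\le p-1$, where $\alpha(x_i)\neq\alpha(x_j)$ for $i\neq j$; (11) $\sum_{\sigma\in H_p}x_{\sigma(1)}\cdots x_{\sigma(p)}$, where $(\alpha(x_1),\dots,\alpha(x_p))$ is a complete sequence of $\mathbb{Z}_p$. In (8) and (9), $z_1,z_2\in\bigcup_{g\in\mathbb{Z}_p}X_g$; throughout, the $x_i$ are variables in $\bigcup_{g\in\mathbb{Z}_p}X_g$.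
   Context: Canonical $\mathbb{Z}_p$-grading of $M_p(K)$: the matrix unit $e_{ij}$ has degree $\overline{j-i}\in\mathbb{Z}_p$. $X=\bigcup_{g\in \mathbb{Z}_p}X_g$ is a disjoint union of countable sets of variables and $K\langle X\rangle$ is the free (unital) associative $K$-algebra on $X$. A variable $x\in X_g$ has degree $\alpha(x)=g$, and the degree of a monomial is the sum of the degrees of its letters; $K\langle X\rangle_g$ is the $K$-span of monomials of degree $g$. A graded endomorphism $\phi$ of $K\langle X\rangle$ satisfies $\phi(K\langle X\rangle_g)\subset K\langle X\rangle_g$ for all $g$. A $T_{\mathbb{Z}_p}$-space is a graded $K$-submodule of $K\langle X\rangle$ invariant under all graded endomorphisms; the $T_{\mathbb{Z}_p}$-space generated by a set is the intersection of all $T_{\mathbb{Z}_p}$-spaces containing it. A polynomial $f(x_1,\dots,x_m)\in K\langle X\rangle$ is a $\mathbb{Z}_p$-graded central polynomial of $A=M_p(K)$ if $f(0,\dots,0)=0$ and $f(a_1,\dots,a_m)$ lies in the centre $Z(A)$ for all $a_i\in A_{\alpha(x_i)}$; $C_{\mathbb{Z}_p}(A)$ is the set of all of them. $H_p$ is the subgroup of the symmetric group $S_p$ generated by the cycle $(1\,2\cdots p)$. A sequence $(\gamma_1,\dots,\gamma_p)$ of elements of $\mathbb{Z}_p$ is a complete sequence if $\gamma_1+\cdots+\gamma_p=0$ and $\{\gamma_1,\gamma_1+\gamma_2,\dots,\gamma_1+\cdots+\gamma_p\}=\mathbb{Z}_p$.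
   Formalization: In (10) for p>2 the degrees α(x_i) are also required to be nonzero, since otherwise x_1^p with α(x_1)=0 takes the non-central value diag(1,0,…,0) and the claim as printed fails. *)

(* Defs.v *)
From mathcomp Require Export all_boot all_order all_algebra all_fingroup.
From mathcomp Require Export finmap monalg.

Set Implicit Arguments.
Unset Strict Implicit.
Unset Printing Implicit Defensive.

Import GRing.Theory.
Local Open Scope ring_scope.

(* (g, n) is the n-th variable of X_g. As everywhere below, 'Z_p is the ring
   of integers modulo p only when 1 < p. *)
Notation gvar p := ('Z_p * nat)%type.

Notation freealg K p := {malg K[{fmonom gvar p}]}.

Definition infinite_type (T : eqType) : Prop :=
  forall s : seq T, exists x, x \notin s.

Section FreeAlgebra.
Context (K : idomainType) (p : nat).

Definition alpha (x : gvar p) : 'Z_p := x.1.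

Definition var (x : gvar p) : freealg K p := << fmu x >>.

Definition mondeg (m : {fmonom gvar p}) : 'Z_p := \sum_(x <- m) alpha x.

(* The K-span K<X>_g of the monomials of degree g. *)
Definition homogeneous (g : 'Z_p) (f : freealg K p) : Prop :=
  forall m, m \in msupp f -> mondeg m = g.

Definition hcomp (g : 'Z_p) (f : freealg K p) : freealg K p :=
  \sum_(m <- msupp f | mondeg m == g) << f@_m *g m >>.

Definition graded_endo (phi : {lrmorphism freealg K p -> freealg K p}) : Prop :=
  forall g f, homogeneous g f -> homogeneous g (phi f).

Definition graded_submodule (S : freealg K p -> Prop) : Prop :=
  [/\ S 0,
      forall f1 f2, S f1 -> S f2 -> S (f1 + f2),
      forall (c : K) f, S f -> S (c *: f) &
      forall g f, S f -> S (hcomp g f)].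

Definition Tspace (S : freealg K p -> Prop) : Prop :=
  graded_submodule S /\
  (forall phi : {lrmorphism freealg K p -> freealg K p},
     graded_endo phi -> forall f, S f -> S (phi f)).

Definition Tspace_generated (G : freealg K p -> Prop) (f : freealg K p) : Prop :=
  forall S, Tspace S -> (forall q, G q -> S q) -> S f.

End FreeAlgebra.

Arguments var K {p} x.

Section Matrices.
Context (K : idomainType) (p : nat).

(* The component of degree g of the canonical grading: the span of the matrix
   units e_ij such that j - i = g modulo p. *)
Definition mxcomp (g : 'Z_p) (a : 'M[K]_p) : Prop :=
  forall i j : 'I_p, (j%:R - i%:R : 'Z_p) != g -> a i j = 0.

Definition mxcenter (c : 'M[K]_p) : Prop :=
  forall b : 'M[K]_p, c *m b = b *m c.

(* Substitution of a x for every variable x; only the values of a at the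
   finitely many variables of f matter. *)
Definition evalmx (a : gvar p -> 'M[K]_p) (f : freealg K p) : 'M[K]_p :=
  \sum_(m <- msupp f) f@_m *: \big[mulmx/1%:M]_(x <- m) a x.

Definition graded_central (f : freealg K p) : Prop :=
  evalmx (fun=> 0) f = 0 /\
  (forall a : gvar p -> 'M[K]_p,
     (forall x, mxcomp (alpha x) (a x)) -> mxcenter (evalmx a f)).

End Matrices.

Section Generators.
Context (K : idomainType) (p : nat).

Definition gen_comm (f : freealg K p) : Prop :=
  exists z1 z2 x1 x2 : gvar p,
    [/\ alpha x1 = 0, alpha x2 = 0 &
        f = var K z1 * (var K x1 * var K x2 - var K x2 * var K x1) * var K z2].

Definition gen_swap (f : freealg K p) : Prop :=
  exists z1 z2 x1 x2 x3 : gvar p,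
    [/\ alpha x1 = - alpha x2, - alpha x2 = alpha x3, alpha x3 != 0 &
        f = var K z1 *
            (var K x1 * var K x2 * var K x3 - var K x3 * var K x2 * var K x1) *
            var K z2].

Definition gen_pow2 (f : freealg K p) : Prop :=
  exists z1 z2 : freealg K p,
    [/\ homogeneous 1 z1, homogeneous 1 z2 &
        f = z1 ^+ 2 \/ f = z1 ^+ 2 * z2 ^+ 2].

(* The degrees have to be nonzero: if alpha x = 0 then x ^+ p takes the value
   diag (d_1 ^+ p, ..., d_p ^+ p), which is not central in general. This is
   also why there are at most p - 1 distinct degrees. *)
Definition gen_powp (f : freealg K p) : Prop :=
  exists (l : nat) (x : 'I_l -> gvar p),
    [/\ (1 <= l <= p - 1)%N,
        forall i, alpha (x i) != 0,
        forall i j, i != j -> alpha (x i) != alpha (x j) &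
        f = \prod_(i < l) var K (x i) ^+ p].

Definition gen_pow (f : freealg K p) : Prop :=
  (p = 2 /\ gen_pow2 f) \/ ((2 < p)%N /\ gen_powp f).

Definition complete_sequence (gamma : 'I_p -> 'Z_p) : Prop :=
  \sum_(i < p) gamma i = 0 /\
  [set \sum_(i < p | (i <= k)%N) gamma i | k : 'I_p] = [set: 'Z_p].

(* The indices are 0, ..., p - 1, so that the cycle maps i to i + 1 modulo p. *)
Definition full_cycle : 'S_p := perm (@ordS_inj p).

Definition gen_cyclic (f : freealg K p) : Prop :=
  exists x : 'I_p -> gvar p,
    complete_sequence (fun i => alpha (x i)) /\
    f = \sum_(s in <[full_cycle]>%g) \prod_(i < p) var K (x (s i)).

Definition generators (f : freealg K p) : Prop :=
  [\/ gen_comm f, gen_swap f, gen_pow f | gen_cyclic f].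

End Generators.

(* Main.v *)
From HB Require Import structures.
Require Import Defs.
From mathcomp Require Import ring zify.

Set Implicit Arguments.
Unset Strict Implicit.
Unset Printing Implicit Defensive.

Import GRing.Theory.
Local Open Scope ring_scope.

(** A word read from a vertex [i] of Z_p is a walk in which a letter [x] leads
    from [s] to [s + alpha x].  When graded matrices are substituted, the entry
    [(i, j)] of the word is zero unless the walk ends at [j], and is then the
    product, over the steps [(s, x)] of the walk, of the entries of the value of
    [x] in row [s].  These entries are independent parameters, and over an
    infinite domain a polynomial function determines its coefficients
    ([eval_determines_coef]), so a word counts only through its multiset of
    steps.

    Two walks from one vertex with the same multiset of steps are Eulerian trails
    of one labelled multigraph.  They are linked by moves that reverse the order
    of three consecutive segments, the outer two leading from a vertex [s] to a
    vertex [t] and the middle one back ([eulerian_exchange]).  Such a move is a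
    consequence of the commutator generators when [s = t] and of the generators
    in three variables otherwise, so words with equal multisets of steps agree
    modulo the T-space ([Tspace_eulerian]).

    A polynomial is therefore governed by its class sums: for each multiset of
    steps, the sum of the coefficients of the words that have it.  Centrality
    says that class sums vanish in nonzero degree, and in degree zero are
    unchanged by translation of the vertices ([class_coef_degree_neq0],
    [class_coef_shift]).  As [p] is prime, an orbit of Z_p on multisets of steps
    is either free or a single point.
    - On a free orbit with nonzero class sum every translate occurs from vertex
      0, so the walk visits all vertices.  Cutting it at its first visits gives
      [p] words whose degrees form a complete sequence, and the cyclic generator
      evaluated at them is the sum of the orbit ([cyclic_shifts]).
    - At a fixed multiset every letter leaves every vertex equally often, hence
      the word is congruent to a product of [p]-th powers of words of nonzero
      degree.  For odd [p] two words of the same degree [d] may be merged into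
      one of degree [2 d], still nonzero, until all degrees differ; for [p = 2]
      three words of degree 1 may be merged into one
      ([shift_invariant_powers]).

    Conversely the graded central polynomials form a T-space
    ([graded_central_Tspace]) that contains the generators
    ([generators_central]).  The only delicate point is the constant term, since
    an endomorphism may add constants to the variables of degree zero: a graded
    central polynomial vanishes at all scalar values of these variables when the
    other variables are zero ([graded_central_scalar]). *)

(** * Words as walks on Z_p *)

Section Words.
Variable p : nat.
Notation word := (seq (gvar p)).
Notation edge := ('Z_p * gvar p)%type.
Implicit Types (u v w : word) (i j k : 'Z_p).

Definition wdeg w : 'Z_p := \sum_(x <- w) alpha x.

Lemma wdeg_nil : wdeg [::] = 0.
Proof. by rewrite /wdeg big_nil. Qed.

Lemma wdeg_cons x w : wdeg (x :: w) = alpha x + wdeg w.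
Proof. by rewrite /wdeg big_cons. Qed.

Lemma wdeg_cat u v : wdeg (u ++ v) = wdeg u + wdeg v.
Proof. by rewrite /wdeg big_cat. Qed.

Lemma wdeg_seq1 x : wdeg [:: x] = alpha x.
Proof. by rewrite /wdeg big_seq1. Qed.

Lemma perm_wdeg u v : perm_eq u v -> wdeg u = wdeg v.
Proof. exact: perm_big. Qed.

Lemma wdeg_flatten (us : seq word) :
  wdeg (flatten us) = \sum_(u <- us) wdeg u.
Proof.
elim: us => [|u us IH]; first by rewrite big_nil wdeg_nil.
by rewrite /= wdeg_cat IH big_cons.
Qed.

Fixpoint steps i w : seq edge :=
  if w is x :: w' then (i, x) :: steps (i + alpha x) w' else [::].

Lemma steps_cat i u v : steps i (u ++ v) = steps i u ++ steps (i + wdeg u) v.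
Proof.
elim: u i => [|x u IH] i /=; first by rewrite wdeg_nil addr0.
by rewrite IH wdeg_cons addrA.
Qed.

Lemma map_snd_steps i w : map snd (steps i w) = w.
Proof. by elim: w i => //= x w IH i; rewrite IH. Qed.

Lemma perm_steps_letters i j u v :
  perm_eq (steps i u) (steps j v) -> perm_eq u v.
Proof. by move/(perm_map snd); rewrite !map_snd_steps. Qed.

Definition shift k (e : edge) : edge := (k + e.1, e.2).

Lemma map_shiftD k j s : map (shift k) (map (shift j) s) = map (shift (k + j)) s.
Proof. by rewrite -map_comp; apply: eq_map => -[a x]; rewrite /shift /= addrA. Qed.

Lemma map_shift0 s : map (shift 0) s = s.
Proof. by rewrite map_id_in // => -[a x] _; rewrite /shift /= add0r. Qed.

Lemma steps_shift k i w : steps (k + i) w = map (shift k) (steps i w).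
Proof. by elim: w i => //= x w IH i; rewrite -addrA IH. Qed.

Lemma steps_from0 k w : steps k w = map (shift k) (steps 0 w).
Proof. by rewrite -steps_shift addr0. Qed.

Lemma stepsP i w e :
  e \in steps i w -> exists u v, w = u ++ e.2 :: v /\ e.1 = i + wdeg u.
Proof.
elim: w i => //= x w IH i; rewrite inE => /predU1P [-> | /IH [u [v [-> ->]]]].
  by exists [::], w; rewrite wdeg_nil addr0.
by exists (x :: u), v; rewrite wdeg_cons addrA.
Qed.

(** The move that reverses three segments does not change the steps: the two
    outer segments start at the same vertex wherever they are placed. *)
Lemma perm_steps_swap i u1 u2 u3 v :
    wdeg u1 = - wdeg u2 -> wdeg u3 = wdeg u1 ->
  perm_eq (steps i (u1 ++ u2 ++ u3 ++ v)) (steps i (u3 ++ u2 ++ u1 ++ v)).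
Proof.
move=> d1 d3; rewrite !steps_cat d3 d1 subrK.
by apply/seq.permP => P; rewrite !count_cat; ring.
Qed.

Definition verts i w : seq 'Z_p := i :: [seq e.1 + alpha e.2 | e <- steps i w].

Lemma vertsP i w k : k \in verts i w -> exists u v, w = u ++ v /\ k = i + wdeg u.
Proof.
rewrite inE => /predU1P [-> | /mapP [e /stepsP [u [v [-> e1]]] ->]].
  by exists [::], w; rewrite wdeg_nil addr0.
by exists (rcons u e.2), v; rewrite cat_rcons -cats1 wdeg_cat wdeg_seq1 e1 addrA.
Qed.

Lemma steps_invariant (P : pred 'Z_p) i w :
    P i -> (forall e, e \in steps i w -> P e.1 -> P (e.1 + alpha e.2)) ->
  forall e, e \in steps i w -> P e.1.
Proof.
elim: w i => //= x w IH i Pi H e; rewrite inE => /predU1P [-> // | ew].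
apply: IH ew => [|e' e'w]; first by apply: (H (i, x)) Pi; rewrite mem_head.
by apply: H; rewrite inE e'w orbT.
Qed.

(** Let [w'] start with [x]. In [w], the step [(i, x)] comes after a closed walk
    [a] from [i]. If [a] and the rest [b] of [w] share a vertex [v], then the
    segments from [i] to [v] of [a] and of [x :: b] can be exchanged, which
    brings [x] to the front, and induction applies to the tails. If they share no
    vertex, then [w'] enters the component of [b] with its first step and never
    leaves it, although it must use the steps of [a]. *)
Lemma eulerian_exchange (R : word -> word -> Prop) :
    (forall w, R w w) ->
    (forall w1 w2 w3, R w1 w2 -> R w2 w3 -> R w1 w3) ->
    (forall x w1 w2, R w1 w2 -> R (x :: w1) (x :: w2)) ->
    (forall u1 u2 u3 v, wdeg u1 = - wdeg u2 -> wdeg u3 = wdeg u1 ->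
       R (u1 ++ u2 ++ u3 ++ v) (u3 ++ u2 ++ u1 ++ v)) ->
  forall i w w', perm_eq (steps i w) (steps i w') -> R w w'.
Proof.
move=> Rrefl Rtrans Rcons Rswap i w w'.
elim: w' i w => [|x b' IH] i w.
  by move=> /perm_steps_letters /perm_size /size0nil ->.
move=> eq_ww'.
have /stepsP [a [b [/= Dw Di]]]: (i, x) \in steps i w.
  by rewrite (perm_mem eq_ww') mem_head.
have da0 : wdeg a = 0 by apply: (addrI i); rewrite addr0 -Di.
case: (eqVneq a [::]) => [a_nil | a_neq0].
  move: eq_ww'; rewrite Dw a_nil /= perm_cons => /IH; exact: Rcons.
pose k := i + alpha x.
(* The steps that [w'] still has to make after its first one. *)
have eq_b' : perm_eq (steps k b') (steps i a ++ steps k b).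
  move: eq_ww'; rewrite Dw steps_cat da0 addr0 /= perm_sym => eq_ww'.
  by rewrite -(perm_cons (i, x)) (perm_trans eq_ww') // -cat1s perm_catCA.
have [/hasP[v v_b v_a] | ] := boolP (has (mem (map fst (steps i a))) (verts k b)).
  have [a1 [a2 [Da Dv]]] : exists a1 a2, a = a1 ++ a2 /\ v = i + wdeg a1.
    case/mapP: v_a => e /stepsP [a1 [a2 [-> De]]] ->.
    by exists a1, (e.2 :: a2).
  have [c [d [Db Dv']]] := vertsP v_b.
  have dc : wdeg (x :: c) = wdeg a1.
    by rewrite wdeg_cons; apply: (addrI i); rewrite -Dv Dv' addrA.
  have da : wdeg a1 = - wdeg a2.
    by apply/eqP; rewrite -addr_eq0 -wdeg_cat -Da da0.
  have Dw2 : w = a1 ++ a2 ++ (x :: c) ++ d by rewrite Dw Da Db -catA.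
  have := Rswap a1 a2 (x :: c) d da dc; rewrite -Dw2 => /Rtrans; apply.
  rewrite /=; apply: Rcons; apply: (IH k).
  rewrite -(perm_cons (i, x)) -[_ :: steps k b']/(steps i (x :: b')).
  apply: (perm_trans _ eq_ww'); rewrite Dw2 perm_sym.
  exact: (perm_steps_swap i d da dc).
(* Steps from a vertex of [b] are steps of [b], so [b'] stays on these vertices. *)
move=> /hasPn no_common; exfalso.
have Pb' := @steps_invariant (mem (verts k b)) k b' (mem_head _ _) _.
case: a => // y a in da0 Dw Di a_neq0 eq_b' no_common Pb' *.
have : i \in verts k b.
  apply: (Pb' _ (i, y)) => [e|]; last by rewrite (perm_mem eq_b') mem_head.
  rewrite (perm_mem eq_b') mem_cat => /orP [ea /no_common /negP [] | eb _].
    exact: (map_f fst ea).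
  by rewrite !inE; apply/orP; right; apply/mapP; exists e.
by move/no_common; rewrite inE /= mem_head.
Qed.

Fixpoint starts i (us : seq word) : seq 'Z_p :=
  if us is u :: us' then i :: starts (i + wdeg u) us' else [::].

Lemma size_starts i us : size (starts i us) = size us.
Proof. by elim: us i => //= u us IH i; rewrite IH. Qed.

Lemma starts_rcons i us u :
  starts i (rcons us u) = rcons (starts i us) (i + wdeg (flatten us)).
Proof.
elim: us i => [|v us IH] i /=; first by rewrite wdeg_nil addr0.
by rewrite IH wdeg_cat addrA.
Qed.

Lemma nth_starts i us r : (r < size us)%N ->
  nth 0 (starts i us) r = i + wdeg (flatten (take r us)).
Proof.
elim: us i r => //= u us IH i [|r] /=; first by rewrite wdeg_nil addr0.
by rewrite ltnS => /IH ->; rewrite wdeg_cat addrA.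
Qed.

(** A letter that is read from a vertex seen before extends the last word, and one
    that is read from a new vertex opens a new word. *)
Lemma cut_at_first_visits i w : w != [::] ->
  exists us, [/\ flatten us = w, uniq (starts i us) &
                 starts i us =i map fst (steps i w)].
Proof.
elim/last_ind: w => // w x IH _; case: (eqVneq w [::]) => [-> | /IH].
  by exists [:: [:: x]].
case=> us [Dw Uus Eus].
have Dsteps : steps i (rcons w x) = rcons (steps i w) (i + wdeg w, x).
  by rewrite -cats1 steps_cat cats1.
have [vin | vnotin] := boolP (i + wdeg w \in starts i us).
  case/lastP: us => // us u in Dw Uus Eus vin *.
  exists (rcons us (rcons u x)); split=> [||y].
  - by rewrite -Dw !flatten_rcons rcons_cat.
  - by move: Uus; rewrite !starts_rcons.
  - move: vin (Eus y).
    rewrite Dsteps map_rcons mem_rcons !starts_rcons inE => vin <-.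
    by case: eqVneq => // ->.
exists (rcons us [:: x]); split=> [||y].
- by rewrite flatten_rcons Dw cats1.
- by rewrite starts_rcons Dw rcons_uniq vnotin.
- by rewrite starts_rcons Dw Dsteps map_rcons !mem_rcons !inE Eus.
Qed.

(** Rotating a closed walk keeps its steps, but reading the rotated word from
    vertex 0 again translates them. *)
Lemma steps_rotate us r : wdeg (flatten us) = 0 ->
  perm_eq (steps 0 (flatten us))
    (map (shift (wdeg (flatten (take r us)))) (steps 0 (flatten (rot r us)))).
Proof.
rewrite -{1 2}[us](cat_take_drop r) /rot !flatten_cat wdeg_cat => d0.
rewrite -steps_from0 !steps_cat d0 perm_sym add0r.
by rewrite perm_catC.
Qed.

End Words.

(** * Evaluation of noncommutative polynomials *)

Section Substitution.
Variables (K : idomainType) (p : nat).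
Notation word := (seq (gvar p)).
Notation F := (freealg K p).
Implicit Types (f g : F) (u v w : word) (m : {fmonom gvar p}).

Definition mon w : F := << FMonom w >>.

Lemma monE m : mon m = << m >>.
Proof. by case: m. Qed.

Lemma fmonomM (m1 m2 : {fmonom gvar p}) : mmul m1 m2 = FMonom (m1 ++ m2).
Proof. by apply: val_inj; rewrite /= fmM. Qed.

Lemma fmonom1 : mone = FMonom [::] :> {fmonom gvar p}.
Proof. by apply: val_inj; rewrite /= fm1. Qed.

Lemma mon_nil : mon [::] = 1.
Proof. by rewrite /mon -fmonom1. Qed.

Lemma malgUM (c1 c2 : K) m1 m2 :
  << c1 *g m1 >> * << c2 *g m2 >> = << c1 * c2 *g mmul m1 m2 >> :> F.
Proof. by rewrite malgM_def fgmulUU. Qed.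

Lemma mon_cat u v : mon (u ++ v) = mon u * mon v.
Proof. by rewrite /mon malgUM mulr1 fmonomM. Qed.

Lemma malgU_scale (c : K) m : << c *g m >> = c *: mon m.
Proof. by rewrite -mul_malgC monE malgUM mulr1 mul1m. Qed.

Lemma var_mon x : var K x = mon [:: x].
Proof. by rewrite /var /mon fmuE. Qed.

Lemma mon_flatten (us : seq word) : mon (flatten us) = \prod_(u <- us) mon u.
Proof.
elim: us => [|u us IH]; first by rewrite big_nil mon_nil.
by rewrite /= mon_cat IH big_cons.
Qed.

Lemma mon_prod w : mon w = \prod_(x <- w) var K x.
Proof.
rewrite -{1}[w]flatten_seq1 mon_flatten big_map.
by apply: eq_bigr => x _; rewrite var_mon.
Qed.

Lemma freealgE f : f = \sum_(m <- msupp f) f@_m *: mon m.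
Proof. by rewrite {1}[f]monalgE; apply: eq_bigr => m _; rewrite malgU_scale. Qed.

Lemma malgC_comm (c : K) f : c%:MP * f = f * c%:MP.
Proof.
rewrite [f]monalgE mulr_sumr mulr_suml; apply: eq_bigr => m _.
by rewrite !malgUM mulrC; congr << _ *g _ >>; rewrite mul1m mulm1.
Qed.

Lemma freealg_scaleAr (c : K) f g : c *: (f * g) = f * (c *: g).
Proof. by rewrite -!mul_malgC mulrA malgC_comm mulrA. Qed.

(** The scalars of [A] are assumed central through [scaleAr] rather than through
    an algebra structure, so that [A] may be the free algebra itself. *)
Section Eval.
Variables (A : lalgType K) (a : gvar p -> A).
Hypothesis scaleAr : forall c (x y : A), c *: (x * y) = x * (c *: y).

Definition alg_eval f : A := \sum_(m <- msupp f) f@_m *: \prod_(x <- m) a x.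

Let wordval m : A := \prod_(x <- m) a x.

Let wordval_mmorphism : mmorphism wordval.
Proof.
split=> [m1 m2|]; rewrite /wordval; first by rewrite fmM big_cat.
by rewrite fm1 big_nil.
Qed.

HB.instance Definition _ := isMultiplicative.Build _ _ wordval wordval_mmorphism.

Let substE : alg_eval =1 mmap (in_alg A) wordval.
Proof. by move=> f; apply: eq_bigr => m _; rewrite mulr_algl. Qed.

Lemma alg_eval_zmod_morphism : zmod_morphism alg_eval.
Proof. by move=> f g; rewrite !substE raddfB. Qed.

Lemma alg_eval_scalable : scalable alg_eval.
Proof. by move=> c f; rewrite !substE mmapZ mulr_algl. Qed.

Lemma alg_eval_monoid_morphism : monoid_morphism alg_eval.
Proof.
have comm_scalar (g : F) m m' : GRing.comm (in_alg A g@_m) (wordval m').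
  by rewrite /GRing.comm mulr_algl -[in LHS](mulr1 (wordval m')) scaleAr.
have [mapM map1] := commr_mmap_is_multiplicative comm_scalar.
by split=> [|f g]; rewrite !substE.
Qed.

Lemma alg_eval_mon w : alg_eval (mon w) = \prod_(x <- w) a x.
Proof. by rewrite substE mmapU /= scale1r mul1r. Qed.

Lemma alg_eval_var x : alg_eval (var K x) = a x.
Proof. by rewrite var_mon alg_eval_mon big_seq1. Qed.

End Eval.

Definition endo (a : gvar p -> F) : F -> F := alg_eval a.

Section Endo.
Variable a : gvar p -> F.

HB.instance Definition _ :=
  GRing.isZmodMorphism.Build F F (endo a) (alg_eval_zmod_morphism a).
HB.instance Definition _ :=
  GRing.isMonoidMorphism.Build F F (endo a)
    (alg_eval_monoid_morphism a freealg_scaleAr).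
HB.instance Definition _ :=
  GRing.isScalable.Build K F F *:%R (endo a) (alg_eval_scalable a).

End Endo.

End Substitution.

(** * Homogeneous polynomials and graded endomorphisms *)

Section Homogeneous.
Variables (K : idomainType) (p : nat).
Notation word := (seq (gvar p)).
Notation F := (freealg K p).
Implicit Types (f g : F) (u v w : word) (m : {fmonom gvar p}) (i j : 'Z_p).

Lemma homogeneousE i f :
  homogeneous i f <-> forall m, mondeg m != i -> f@_m = 0.
Proof.
split=> [hf m | hf m].
  by move=> dm; apply: mcoeff_outdom; apply: contra dm => /hf ->.
by rewrite -mcoeff_neq0; apply: contraNeq => /hf ->.
Qed.

Lemma homogeneous0 i : homogeneous i (0 : F).
Proof. by apply/homogeneousE => m _; rewrite mcoeff0. Qed.

Lemma homogeneousD i f g :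
  homogeneous i f -> homogeneous i g -> homogeneous i (f + g).
Proof.
move=> /homogeneousE hf /homogeneousE hg; apply/homogeneousE => m dm.
by rewrite mcoeffD hf ?hg ?addr0.
Qed.

Lemma homogeneousZ i c f : homogeneous i f -> homogeneous i (c *: f).
Proof.
move=> /homogeneousE hf; apply/homogeneousE => m dm.
by rewrite mcoeffZ hf ?mulr0.
Qed.

Lemma homogeneous_sum (I : eqType) (r : seq I) (P : pred I) (G : I -> F) i :
    (forall k, k \in r -> P k -> homogeneous i (G k)) ->
  homogeneous i (\sum_(k <- r | P k) G k).
Proof.
move=> hG; rewrite big_seq_cond; apply: big_rec => [|k f /andP [kr Pk] hf].
  exact: homogeneous0.
by apply: homogeneousD hf; exact: hG.
Qed.

Lemma homogeneous_mon w : homogeneous (wdeg w) (mon K w).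
Proof. by move=> m; rewrite msuppU oner_eq0 inE => /eqP ->. Qed.

Lemma homogeneousM i j f g :
  homogeneous i f -> homogeneous j g -> homogeneous (i + j) (f * g).
Proof.
move=> hf hg; rewrite malgME; apply: homogeneous_sum => m /hf dm _.
apply: homogeneous_sum => m' /hg dm' _; rewrite malgU_scale.
apply: homogeneousZ; rewrite fmonomM -dm -dm' -[mondeg m + _]wdeg_cat.
exact: homogeneous_mon.
Qed.

Lemma homogeneous_prod (a : gvar p -> F) w :
  (forall x, homogeneous (alpha x) (a x)) ->
  homogeneous (wdeg w) (\prod_(x <- w) a x).
Proof.
move=> ha; elim: w => [|x w IH]; last first.
  by rewrite big_cons wdeg_cons; apply: homogeneousM.
by rewrite big_nil -mon_nil; exact: homogeneous_mon.
Qed.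

Lemma graded_endo_endo (a : gvar p -> F) :
  (forall x, homogeneous (alpha x) (a x)) -> graded_endo (endo a).
Proof.
move=> ha i f hf; apply: homogeneous_sum => m /hf <- _.
by apply: homogeneousZ; exact: homogeneous_prod.
Qed.

(** Variable [k] of degree [wdeg u], for [u] the [k]-th word of [us], is sent to
    [u]. Carrying the index [k] keeps the variables distinct when words of [us]
    have the same degree; the value 0 elsewhere is homogeneous of any degree. *)
Definition word_subst (us : seq word) (x : gvar p) : F :=
  if wdeg (nth [::] us x.2) == alpha x then mon K (nth [::] us x.2) else 0.

Definition placeholder (us : seq word) (k : nat) : gvar p :=
  (wdeg (nth [::] us k), k).

Lemma word_subst_graded us : graded_endo (endo (word_subst us)).
Proof.
apply: graded_endo_endo => x; rewrite /word_subst; case: eqP => [<- | _].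
  exact: homogeneous_mon.
exact: homogeneous0.
Qed.

Lemma word_subst_var us k :
  endo (word_subst us) (var K (placeholder us k)) = mon K (nth [::] us k).
Proof. by rewrite /endo alg_eval_var /word_subst /= eqxx. Qed.

End Homogeneous.

Section MorphismRewriting.
Variables (A B : pzRingType) (phi : {rmorphism A -> B}).

Lemma rmorph_commutator f1 f2 f3 f4 g1 g2 g3 g4 :
    phi f1 = g1 -> phi f2 = g2 -> phi f3 = g3 -> phi f4 = g4 ->
  phi (f1 * (f2 * f3 - f3 * f2) * f4)
    = g1 * (g2 * (g3 * g4)) - g1 * (g3 * (g2 * g4)).
Proof. by move=> <- <- <- <-; rewrite !(rmorphM, rmorphB) mulrBr mulrBl !mulrA. Qed.

Lemma rmorph_reversal f1 f2 f3 f4 f5 g1 g2 g3 g4 g5 :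
    phi f1 = g1 -> phi f2 = g2 -> phi f3 = g3 -> phi f4 = g4 -> phi f5 = g5 ->
  phi (f1 * (f2 * f3 * f4 - f4 * f3 * f2) * f5)
    = g1 * (g2 * (g3 * (g4 * g5))) - g1 * (g4 * (g3 * (g2 * g5))).
Proof.
by move=> <- <- <- <- <-; rewrite !(rmorphM, rmorphB) mulrBr mulrBl !mulrA.
Qed.

End MorphismRewriting.

(** * Congruences in a T-space that contains the generators *)

Section Tspaces.
Variables (K : idomainType) (p : nat) (S : freealg K p -> Prop).
Hypotheses (S_Tspace : Tspace S) (S_generators : forall f, generators f -> S f).
Notation word := (seq (gvar p)).
Notation F := (freealg K p).
Notation mon := (@mon K p).
Implicit Types (f g : F) (u v w : word) (i j : 'Z_p).

Lemma Tspace0 : S 0.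
Proof. by have [[]] := S_Tspace. Qed.

Lemma TspaceD f g : S f -> S g -> S (f + g).
Proof. have [[_ SD _ _] _] := S_Tspace; exact: SD. Qed.

Lemma TspaceZ c f : S f -> S (c *: f).
Proof. have [[_ _ SZ _] _] := S_Tspace; exact: SZ. Qed.

Lemma Tspace_sum (I : eqType) (r : seq I) (P : pred I) (G : I -> F) :
    (forall k, k \in r -> P k -> S (G k)) -> S (\sum_(k <- r | P k) G k).
Proof.
move=> hG; rewrite big_seq_cond; apply: big_rec => [|k f /andP [kr Pk] hf].
  exact: Tspace0.
by apply: TspaceD hf; exact: hG.
Qed.

Lemma Tspace_word_subst us f : S f -> S (endo (word_subst K us) f).
Proof. by have [_] := S_Tspace; apply; exact: word_subst_graded. Qed.

(** A T-space is not an ideal in general: multiplication by [u] and [v] on the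
    two sides comes from the outer variables of the generator. *)
Lemma Tspace_commute u v w1 w2 : wdeg w1 = 0 -> wdeg w2 = 0 ->
  S (mon (u ++ w1 ++ w2 ++ v) - mon (u ++ w2 ++ w1 ++ v)).
Proof.
move=> d1 d2; pose us := [:: u; v; w1; w2]; pose x := placeholder us.
have /S_generators /(Tspace_word_subst us) :
    generators (var K (x 0) * (var K (x 2) * var K (x 3)
                  - var K (x 3) * var K (x 2)) * var K (x 1)).
  by constructor 1; exists (x 0), (x 1), (x 2), (x 3).
have E k := word_subst_var K us k.
by rewrite (rmorph_commutator (E 0) (E 2) (E 3) (E 1)) !mon_cat.
Qed.

Lemma Tspace_reverse u v w1 w2 w3 :
    wdeg w1 = - wdeg w2 -> wdeg w3 = wdeg w1 ->
  S (mon (u ++ w1 ++ w2 ++ w3 ++ v) - mon (u ++ w3 ++ w2 ++ w1 ++ v)).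
Proof.
move=> d12 d31; have [d10 | d1_neq0] := eqVneq (wdeg w1) 0.
  have d20 : wdeg w2 = 0 by rewrite -[wdeg w2]opprK -d12 d10 oppr0.
  have d30 : wdeg w3 = 0 by rewrite d31.
  (* Here all three segments are closed, and commuting them twice reverses them. *)
  have d230 : wdeg (w2 ++ w3) = 0 by rewrite wdeg_cat d20 d30 addr0.
  have := TspaceD (Tspace_commute u v d10 d230)
                  (Tspace_commute u (w1 ++ v) d20 d30).
  by rewrite -!catA addrA subrK.
pose us := [:: u; v; w1; w2; w3]; pose x := placeholder us.
have /S_generators /(Tspace_word_subst us) :
    generators (var K (x 0) * (var K (x 2) * var K (x 3) * var K (x 4)
                  - var K (x 4) * var K (x 3) * var K (x 2)) * var K (x 1)).
  constructor 2; exists (x 0), (x 1), (x 2), (x 3), (x 4).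
  by split; rewrite /alpha /= ?d31.
have E k := word_subst_var K us k.
by rewrite (rmorph_reversal (E 0) (E 2) (E 3) (E 4) (E 1)) !mon_cat.
Qed.

(** Two-sided multiplication is built into the relation to which
    [eulerian_exchange] is applied, which makes it compatible with prefixes. *)
Lemma Tspace_eulerian i w w' :
  perm_eq (steps i w) (steps i w') -> S (mon w - mon w').
Proof.
pose R w w' := forall u v, S (mon (u ++ w ++ v) - mon (u ++ w' ++ v)).
suff RP : forall w w', perm_eq (steps i w) (steps i w') -> R w w'.
  by move/RP/(_ [::] [::]); rewrite !cats0.
move=> {}w {}w'; apply: eulerian_exchange; rewrite {}/R.
- by move=> {}w u v; rewrite subrr; exact: Tspace0.
- move=> w1 w2 w3 H12 H23 u v; have := TspaceD (H12 u v) (H23 u v).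
  by rewrite addrA subrK.
- by move=> x w1 w2 H12 u v; have := H12 (rcons u x) v; rewrite !cat_rcons.
- move=> w1 w2 w3 w4 d12 d31 u v.
  by have := Tspace_reverse u (w4 ++ v) d12 d31; rewrite -!catA.
Qed.

(** The conditions under which the generators provide the product of the [p]-th
    powers of the words of [us]. For [p = 2] all words of nonzero degree have
    degree 1, and one or two of them are allowed. *)
Definition admissible_blocks (us : seq word) :=
  [&& us != [::], 0 \notin map (@wdeg p) us &
      if p == 2 then (size us <= 2)%N else uniq (map (@wdeg p) us)].

Lemma Tspace_pow us : prime p -> admissible_blocks us ->
  S (\prod_(u <- us) mon u ^+ p).
Proof.
move=> p_prime /and3P [us_neq0 deg_neq0]; case: eqP => [p2 size_us | p_neq2 Udeg].
  have degree1 u : u \in us -> homogeneous 1 (mon u).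
    move=> u_us; suff <- : wdeg u = 1 by exact: homogeneous_mon.
    have : wdeg u != 0 by apply: contraNneq deg_neq0 => <-; exact: map_f.
    by move: (wdeg u); rewrite p2; case=> [[|[|]]] // lt _; apply: val_inj.
  apply: S_generators; constructor 3; left; split=> //.
  case: us us_neq0 deg_neq0 size_us degree1 => // u [|v []] // _ _ _ H.
    exists (mon u), (mon u); split; try exact/H/mem_head.
    by left; rewrite big_seq1 [X in _ ^+ X]p2.
  exists (mon u), (mon v); split; try by apply: H; rewrite !inE eqxx ?orbT.
  by right; rewrite big_cons big_seq1 [X in _ ^+ X * _]p2 [X in _ * _ ^+ X]p2.
have p_gt2 : (2 < p)%N by rewrite ltn_neqAle eq_sym prime_gt1 // andbT; exact/eqP.
pose x (k : 'I_(size us)) := placeholder us k.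
have /S_generators /(Tspace_word_subst us) :
    generators (\prod_(k < size us) var K (x k) ^+ p).
  constructor 3; right; split=> //; exists (size us), x; split=> // [|k|k l kl].
  - rewrite lt0n size_eq0 us_neq0 /=.
    (* There are only [p - 1] nonzero degrees. *)
    have /card_uniqP Dcard : uniq ((0 : 'Z_p) :: map (@wdeg p) us).
      by rewrite /= deg_neq0.
    have := max_card (mem ((0 : 'Z_p) :: map (@wdeg p) us)).
    rewrite Dcard /= size_map card_ord [leqRHS]Zp_cast ?prime_gt1 //.
    by rewrite leq_subRL ?prime_gt0.
  - by apply: contraNneq deg_neq0 => <-; apply: map_f; exact: mem_nth.
  - apply: contraNneq kl; rewrite /alpha /= => /eqP.
    by rewrite -!(nth_map [::] 0 (@wdeg p)) // nth_uniq ?size_map.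
rewrite rmorph_prod (big_nth [::]) big_mkord; congr S; apply: eq_bigr => k _.
by rewrite rmorphXn /= word_subst_var.
Qed.

End Tspaces.

(** * Walks whose steps are invariant under translation *)

Section Full.
Variable p : nat.
Hypothesis p_prime : prime p.
Notation word := (seq (gvar p)).
Notation edge := ('Z_p * gvar p)%type.
Implicit Types (u v w : word) (us : seq word) (i k d : 'Z_p).

Let p_gt1 : (1 < p)%N := prime_gt1 p_prime.

Lemma Zp_mulrn_inj d : d != 0 -> {in gtn p &, injective (fun n : nat => d *+ n)}.
Proof.
move=> d_neq0 k l; rewrite !inE => kp lp.
have Dd n : (d *+ n : nat) = (d * n %% p)%N.
  by rewrite -[d in LHS](natr_Zp d) -mulrnA val_Zp_nat.
have cop : coprime p d.
  rewrite prime_coprime //; apply: contra d_neq0 => /dvdn_leq.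
  case: (posnP d) => [d0 _ | d_gt0 /(_ isT)]; first by apply/eqP/val_inj.
  by rewrite leqNgt -[X in (_ < X)%N](Zp_cast p_gt1) ltn_ord.
move/(congr1 (@nat_of_ord _)); rewrite !Dd => /eqP.
wlog kl : k l kp lp / (k <= l)%N => [th|].
  case/orP: (leq_total k l) => kl; first exact: th.
  by rewrite eq_sym => e; apply/esym; move: e; exact: th.
rewrite eq_sym eqn_mod_dvd ?leq_mul2l ?kl ?orbT // -mulnBr Gauss_dvdr //.
rewrite /dvdn modn_small ?(leq_ltn_trans (leq_subr _ _)) // subn_eq0 => lk.
by apply/eqP; rewrite eqn_leq kl lk.
Qed.

Lemma Zp_mulrnp d : d *+ p = 0.
Proof. by rewrite -mulr_natr pchar_Zp ?mulr0. Qed.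

Lemma perm_multiples i d : d != 0 ->
  perm_eq [seq i + d *+ n | n <- iota 0 p] (enum 'Z_p).
Proof.
move=> d_neq0.
have Uim : uniq [seq i + d *+ n | n <- iota 0 p].
  rewrite map_inj_in_uniq ?iota_uniq // => k l.
  rewrite !mem_iota /= !add0n => kp lp.
  by move/addrI/(Zp_mulrn_inj d_neq0); apply.
apply: uniq_perm => //; first exact: enum_uniq.
have sub_enum : {subset [seq i + d *+ n | n <- iota 0 p] <= enum 'Z_p}.
  by move=> x _; rewrite mem_enum.
have [] // := uniq_min_size Uim sub_enum.
by rewrite (size_map _ (iota 0 p)) size_iota -cardE card_ord [leqLHS]Zp_cast.
Qed.

(** The multiset in which each letter of [w] leaves every vertex exactly as often
    as it occurs in [w]. *)
Definition full w : seq edge :=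
  flatten [seq [seq (k, x) | k <- enum 'Z_p] | x <- w].

Lemma full_cat u v : full (u ++ v) = full u ++ full v.
Proof. by rewrite /full map_cat flatten_cat. Qed.

Lemma perm_full u v : perm_eq u v -> perm_eq (full u) (full v).
Proof. by move=> uv; apply: perm_flatten; exact: perm_map. Qed.

Lemma count_full P w :
  count P (full w) = \sum_(x <- w) count (fun k => P (k, x)) (enum 'Z_p).
Proof.
rewrite /full count_flatten sumnE !big_map; apply: eq_bigr => x _.
by rewrite count_map.
Qed.

Lemma count_mem_full k x w : count_mem (k, x) (full w) = count_mem x w.
Proof.
rewrite count_full -sum1_count [RHS]big_mkcond; apply: eq_bigr => y _.
have [<- | yx] := eqVneq y x.
  rewrite /= eqxx; transitivity (count_mem k (enum 'Z_p)); last first.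
    by rewrite count_uniq_mem ?enum_uniq // mem_enum.
  by apply: eq_count => j; rewrite xpair_eqE eqxx andbT.
rewrite /= (negPf yx); apply/eqP; rewrite -leqn0 leqNgt -has_count.
by apply/hasPn => j _; rewrite xpair_eqE (negPf yx) andbF.
Qed.

Lemma perm_shifts (s : seq edge) :
  perm_eq [seq shift k e | k <- enum 'Z_p, e <- s] (full (map snd s)).
Proof.
elim: s => [|e s IH]; first by rewrite allpairs0r.
have /permPl E := perm_allpairs_consr (@shift p) (enum 'Z_p) (fun=> e) (fun=> s).
apply: perm_trans E _; apply: perm_cat IH.
have -> : [seq shift k e | k <- enum 'Z_p] =
          [seq (k, e.2) | k <- [seq k + e.1 | k <- enum 'Z_p]].
  by rewrite -[RHS]map_comp.
apply: perm_map; apply: uniq_perm; rewrite ?enum_uniq //.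
  by rewrite map_inj_uniq ?enum_uniq //; exact: addIr.
move=> k; rewrite mem_enum; apply/mapP; exists (k - e.1); first by rewrite mem_enum.
by rewrite subrK.
Qed.

Lemma wdeg_nseq m u : wdeg (flatten (nseq m u)) = wdeg u *+ m.
Proof. by elim: m => [|m IH]; rewrite ?wdeg_nil //= wdeg_cat IH mulrS. Qed.

Lemma steps_nseq i m u :
  steps i (flatten (nseq m u)) =
    [seq shift k e | k <- [seq i + wdeg u *+ n | n <- iota 0 m], e <- steps 0 u].
Proof.
elim: m i => //= m IH i; rewrite steps_cat IH mulr0n addr0 -steps_from0.
congr (_ ++ flatten _); rewrite -!map_comp -[1%N in RHS]addn0 iotaDl -map_comp.
by apply: eq_map => n /=; rewrite add1n mulrS addrA.
Qed.

(** As [wdeg u] generates Z_p, the [p] copies of [u] are read from all vertices. *)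
Lemma perm_steps_power i u : wdeg u != 0 ->
  perm_eq (steps i (flatten (nseq p u))) (full u).
Proof.
move=> du; rewrite steps_nseq.
have := perm_shifts (steps 0 u); rewrite map_snd_steps; apply: perm_trans.
exact: perm_allpairs_dep (perm_multiples i du) _.
Qed.

Definition powers us : word := flatten [seq flatten (nseq p u) | u <- us].

Lemma perm_steps_powers us : 0 \notin map (@wdeg p) us ->
  perm_eq (steps 0 (powers us)) (full (flatten us)).
Proof.
rewrite /powers; elim: us => //= u us IH.
rewrite inE negb_or eq_sym => /andP [du /IH {}IH].
rewrite steps_cat full_cat wdeg_nseq add0r Zp_mulrnp.
exact: perm_cat (perm_steps_power _ du) IH.
Qed.
Lemma Zp_addr_neq0 d : (2 < p)%N -> d != 0 -> d + d != 0.
Proof.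
move=> p_gt2 d_neq0; apply/eqP => dd0.
have := @Zp_mulrn_inj d d_neq0 2 0; rewrite !inE mulr0n mulr2n => inj.
by have := inj p_gt2 (ltnW p_gt1) dd0.
Qed.

(** Unlike [admissible_blocks], this allows the empty list, from which the words
    are built by insertion. *)
Definition blocks us : bool :=
  (0 \notin map (@wdeg p) us) &&
  (if p == 2 then (size us <= 2)%N else uniq (map (@wdeg p) us)).

(** If the degree [d] of [u] is taken by [v], the merged word [u ++ v] has degree
    [2 d], which is nonzero, and is inserted into the shorter list without [v]. *)
Lemma insert_block_odd us u : (2 < p)%N -> blocks us -> wdeg u != 0 ->
  exists us', blocks us' /\ perm_eq (flatten us') (u ++ flatten us).
Proof.
move=> p_gt2; rewrite /blocks gtn_eqF //.
move Dn: (size us) => n; elim: n => [|n IH] in us u Dn *.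
  by move/size0nil: Dn => -> _ du; exists [:: u]; rewrite /= inE eq_sym du.
move=> /andP [us0 Uus] du.
have [/mapP [v v_us Dv] | u_notin] := boolP (wdeg u \in map (@wdeg p) us).
  have us_v := perm_to_rem v_us; have us_vE := perm_map (@wdeg p) us_v.
  move: us0 Uus; rewrite (perm_mem us_vE) (perm_uniq us_vE) /= inE negb_or.
  move=> /andP [_ us0] /andP [_ Uus].
  have [|||us' [us'P us'E]] := IH (rem v us) (u ++ v).
  - by rewrite size_rem // Dn.
  - by rewrite us0.
  - by rewrite wdeg_cat -Dv Zp_addr_neq0.
  exists us'; split=> //; apply: perm_trans us'E _.
  rewrite -catA perm_cat2l perm_sym.
  exact: perm_flatten us_v.
by exists (u :: us); rewrite /= inE negb_or eq_sym du us0 u_notin Uus.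
Qed.

(** In degree modulo 2, three words of degree 1 merge into one of degree 1. *)
Lemma insert_block_2 us u : p = 2 -> blocks us -> wdeg u != 0 ->
  exists us', blocks us' /\ perm_eq (flatten us') (u ++ flatten us).
Proof.
move=> p2; have deg1 d : d != 0 -> d = 1.
  by move: d; rewrite p2; case=> [[|[|]]] // lt _; apply: val_inj.
have add11 : 1 + 1 = 0 :> 'Z_p by rewrite -(Zp_mulrnp 1) p2.
have p_eq2 : p == 2 by apply/eqP.
rewrite /blocks p_eq2 => /andP [us0 size_us] du.
case: us us0 size_us => [|v1 [|v2 []]] //= us0 _.
- by exists [:: u]; rewrite /= inE eq_sym du.
- by exists [:: u; v1]; move: us0; rewrite /= !inE negb_or => ->; rewrite eq_sym du.
exists [:: u ++ v1 ++ v2]; rewrite /= !cats0 inE eq_sym !wdeg_cat.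
move: us0; rewrite !inE !negb_or => /andP [d1 d2].
rewrite eq_sym in d1; rewrite eq_sym in d2.
by rewrite (deg1 _ d1) (deg1 _ d2) add11 addr0 du.
Qed.

Lemma insert_block us u : blocks us -> wdeg u != 0 ->
  exists us', blocks us' /\ perm_eq (flatten us') (u ++ flatten us).
Proof.
have [p2|p_neq2] := eqVneq p 2; first exact: insert_block_2.
by apply: insert_block_odd; rewrite ltn_neqAle eq_sym p_neq2.
Qed.

Lemma exists_blocks w : exists us z,
  [/\ blocks us, all (fun x => alpha x == 0) z & perm_eq (flatten us ++ z) w].
Proof.
elim: w => [|x w [us [z [us_ok z0 Dw]]]].
  by exists [::], [::]; split=> //; rewrite /blocks /= if_same.
have [x0 | x_neq0] := eqVneq (alpha x) 0.
  exists us, (x :: z); split=> //=; first by rewrite x0 eqxx.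
  by rewrite -cat1s perm_catCA /= perm_cons.
have [|us' [us'_ok Dus']] := @insert_block us [:: x] us_ok.
  by rewrite wdeg_seq1.
exists us', z; split=> //; rewrite -(perm_cons x) in Dw; apply: perm_trans Dw.
by rewrite -cat1s catA perm_cat2r.
Qed.

(** Letters of degree zero do not affect the degree of a word and can be attached
    to any of the blocks. *)
Lemma exists_admissible_blocks w : has (fun x => alpha x != 0) w ->
  exists us, admissible_blocks us /\ perm_eq (flatten us) w.
Proof.
move=> w_neq0; have [[|u us] [z [us_ok z0 Dw]]] := exists_blocks w.
  by move: w_neq0; rewrite -(perm_has _ Dw) has_predC z0.
have dz : wdeg z = 0.
  by rewrite /wdeg big_seq big1 // => x /(allP z0)/eqP.
exists ((u ++ z) :: us); split; last first.
  by apply: perm_trans Dw; rewrite /= -!catA perm_cat2l perm_catC.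
by move: us_ok; rewrite /admissible_blocks /blocks /= wdeg_cat dz addr0.
Qed.

(** By invariance, a letter leaves each vertex as often as it leaves vertex 0. *)
Lemma shift_invariant_full w :
    perm_eq (steps 0 w) (map (shift 1) (steps 0 w)) ->
  perm_eq (steps 0 w) (full [seq e.2 | e <- steps 0 w & e.1 == 0]).
Proof.
move=> inv1; have inv k : perm_eq (steps 0 w) (map (shift k) (steps 0 w)).
  rewrite -[k]natr_Zp; elim: (nat_of_ord k) => [|n IH]; first by rewrite map_shift0.
  by rewrite (perm_trans inv1) // mulrS -map_shiftD perm_map.
apply/allP => -[k x] _; apply/eqP.
rewrite count_mem_full (seq.permP (inv k)) !count_map count_filter.
apply: eq_count => -[i y]; rewrite /= xpair_eqE /= andbC.
by congr andb; rewrite -subr_eq0 addrAC subrr add0r.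
Qed.

Lemma steps_leave_degree0 i w :
    {in [seq e.2 | e <- steps i w & e.1 == i], forall x, alpha x = 0} ->
  forall e, e \in steps i w -> e.1 = i.
Proof.
move=> deg0 e e_w; apply/eqP.
apply: (steps_invariant (P := pred1 i) _ _ e_w) => //=.
move=> {e_w}e e_w /eqP Di; rewrite deg0 ?addr0 ?Di //.
by apply: map_f; rewrite mem_filter Di eqxx.
Qed.

(** Otherwise the walk would stay at vertex 0, against invariance. *)
Lemma shift_invariant_leaves w : w != [::] ->
    perm_eq (steps 0 w) (map (shift 1) (steps 0 w)) ->
  has (fun x => alpha x != 0) [seq e.2 | e <- steps 0 w & e.1 == 0].
Proof.
case: w => // x w _ inv; apply: contraT => /hasPn deg0.
have src0 := @steps_leave_degree0 0 (x :: w) _.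
have : shift 1 (0, x) \in steps 0 (x :: w).
  by rewrite (perm_mem inv) map_f // mem_head.
move/src0 => /(_ _)/eqP; rewrite /= addr0 oner_eq0; apply.
by move=> y /deg0; rewrite negbK => /eqP.
Qed.

Lemma shift_invariant_powers w : w != [::] ->
    perm_eq (steps 0 w) (map (shift 1) (steps 0 w)) ->
  exists us, admissible_blocks us /\ perm_eq (steps 0 w) (steps 0 (powers us)).
Proof.
move=> w_neq0 inv.
have [us [us_ok Dus]] :=
  exists_admissible_blocks (shift_invariant_leaves w_neq0 inv).
exists us; split=> //; apply: perm_trans (shift_invariant_full inv) _.
case/and3P: us_ok => _ us0 _; rewrite perm_sym.
by apply: perm_trans (perm_steps_powers us0) _; exact: perm_full.
Qed.

End Full.

(** * Cyclic polynomials and walks through all vertices *)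

Lemma nth_rot T (x0 : T) s r i : (r <= size s)%N -> (i < size s)%N ->
  nth x0 (rot r s) i = nth x0 s ((i + r) %% size s).
Proof.
move=> rs lt_is; rewrite /rot nth_cat size_drop ltn_subRL addnC.
case: ltnP => [lt_ir | ge_ir]; first by rewrite nth_drop addnC modn_small.
have Dir : (i + r = i - (size s - r) + size s)%N by lia.
rewrite Dir modnDr modn_small ?nth_take //; first by lia.
exact: leq_ltn_trans (leq_subr _ _) lt_is.
Qed.

Section Rotation.
Variable p : nat.
Hypothesis p_gt0 : (0 < p)%N.

Lemma full_cycleX r (i : 'I_p) : (full_cycle p ^+ r)%g i = ((i + r) %% p)%N :> nat.
Proof.
elim: r => [|r IH]; first by rewrite expg0 perm1 addn0 modn_small.
by rewrite expgSr permM permE /= IH -addn1 modnDml addn1 addnS.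
Qed.

Lemma sum_full_cycle (V : nmodType) (G : 'S_p -> V) :
  \sum_(s in <[full_cycle p]>%g) G s = \sum_(r < p) G (full_cycle p ^+ r)%g.
Proof.
pose i0 := Ordinal p_gt0.
rewrite (reindex_onto (fun r : 'I_p => (full_cycle p ^+ r)%g)
                      (fun s : 'S_p => s i0)).
  apply: eq_bigl => r; rewrite mem_cycle /=.
  by apply/eqP/val_inj; rewrite /= full_cycleX add0n modn_small.
move=> s /cycleP [m ->]; apply/permP => i; apply: val_inj.
by rewrite /= !full_cycleX add0n modnDmr.
Qed.

Lemma prod_full_cycleX (A : pzSemiRingType) T (x0 : T) (s : seq T) (G : T -> A) r :
    size s = p -> (r < p)%N ->
  \prod_(i < p) G (nth x0 s ((full_cycle p ^+ r)%g i)) = \prod_(x <- rot r s) G x.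
Proof.
move=> sz rp; rewrite (big_nth x0) size_rot sz big_mkord; apply: eq_bigr => i _.
by rewrite full_cycleX nth_rot sz // ltnW.
Qed.

End Rotation.

Section CompleteSequences.
Variable p : nat.
Hypothesis p_gt1 : (1 < p)%N.
Implicit Type gamma : 'I_p -> 'Z_p.

Lemma card_Zp_ord : #|'Z_p| = p.
Proof. by rewrite card_ord Zp_cast. Qed.

Lemma imset_setT_inj (h : 'I_p -> 'Z_p) :
  [set h k | k : 'I_p] = setT <-> injective h.
Proof.
have card_eq : #|[set: 'Z_p]| = #|{: 'I_p}| by rewrite cardsT card_Zp_ord card_ord.
split=> [im_h | inj_h].
  by apply: in2T; apply/imset_injP; rewrite im_h card_eq.
by apply/eqP; rewrite eqEcard subsetT card_eq card_imset //= cardE.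
Qed.

Lemma partial_sum_ordS gamma (k : 'I_p) : \sum_(i < p) gamma i = 0 ->
  \sum_(i < p | (i <= k)%N) gamma i = \sum_(i < p | (i < ordS k)%N) gamma i.
Proof.
move=> sum0; have := ltn_ord k; rewrite leq_eqVlt /= => /predU1P [Dk | lt_k].
  rewrite Dk modnn [RHS]big_pred0 // -[RHS]sum0; apply: eq_bigl => i.
  by rewrite -ltnS Dk ltn_ord.
by rewrite modn_small.
Qed.

(** Complete sequences are those whose partial sums, taken from the empty one on,
    are distinct: the total being 0, the sums of the definition are the same up
    to a rotation. *)
Lemma complete_sequenceP gamma : complete_sequence gamma <->
  \sum_(i < p) gamma i = 0 /\
  injective (fun k : 'I_p => \sum_(i < p | (i < k)%N) gamma i).
Proof.
split=> -[sum0 H]; split=> //; last first.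
  by apply/imset_setT_inj => k l; rewrite !partial_sum_ordS // => /H/ordS_inj.
have [g ordSK gK] : bijective (@ordS p) := injF_bij (@ordS_inj p).
move=> k l; rewrite -[k]gK -[l]gK -!partial_sum_ordS //.
by move/imset_setT_inj: H => /[apply] ->.
Qed.

End CompleteSequences.

Section CyclicPolynomials.
Variables (K : idomainType) (p : nat).
Hypothesis p_prime : prime p.
Notation word := (seq (gvar p)).
Implicit Types (w : word) (us : seq word).

Let p_gt0 : (0 < p)%N := prime_gt0 p_prime.
Let p_gt1 : (1 < p)%N := prime_gt1 p_prime.

Lemma partial_wdeg us k : size us = p -> (k <= p)%N ->
  \sum_(i < p | (i < k)%N) wdeg (nth [::] us i) = wdeg (flatten (take k us)).
Proof.
move=> sz kp; rewrite -(big_ord_widen p (fun i => wdeg (nth [::] us i)) kp).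
rewrite wdeg_flatten (big_nth [::]) big_mkord.
by rewrite size_takel ?sz //; apply: eq_bigr => i _; rewrite nth_take.
Qed.

Lemma Tspace_cyclic (S : freealg K p -> Prop) us :
    Tspace S -> (forall f, generators f -> S f) ->
    size us = p -> wdeg (flatten us) = 0 -> uniq (starts 0 us) ->
  S (\sum_(r < p) mon K (flatten (rot r us))).
Proof.
move=> S_T S_gen sz deg0 Us; pose x (i : 'I_p) := placeholder us i.
have /S_gen /(Tspace_word_subst S_T us) :
    generators (\sum_(s in <[full_cycle p]>%g) \prod_(i < p) var K (x (s i))).
  constructor 4; exists x; split=> //; apply/complete_sequenceP => //; split.
    rewrite -[RHS]deg0 -[us in RHS]take_size sz -partial_wdeg //.
    by apply: eq_bigl => i; rewrite ltn_ord.
  move=> k l; rewrite /alpha /= !partial_wdeg // 1?ltnW //.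
  rewrite -[wdeg _]add0r -[RHS]add0r -!nth_starts ?sz // => /eqP.
  by rewrite nth_uniq ?size_starts ?sz // => /eqP/val_inj.
congr S; rewrite raddf_sum sum_full_cycle //; apply: eq_bigr => r _.
rewrite mon_flatten -(@prod_full_cycleX p _ _ [::]) //.
apply: etrans (rmorph_prod (endo (word_subst K us)) _ _ _) _.
by apply: eq_bigr => i _; exact: word_subst_var.
Qed.

(** The cuts at the first visits occur at every vertex exactly once, so the
    rotations of the resulting [p] words realize each translation once. *)
Lemma cyclic_shifts w : w != [::] -> wdeg w = 0 ->
    (forall k : 'Z_p, k \in map fst (steps 0 w)) ->
  exists W : 'Z_p -> word,
    (forall k, perm_eq (map (shift k) (steps 0 w)) (steps 0 (W k))) /\
    forall S : freealg K p -> Prop, Tspace S -> (forall f, generators f -> S f) ->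
      S (\sum_k mon K (W k)).
Proof.
move=> w_neq0 w0 visits; have [us [Dw Us mem_us]] := cut_at_first_visits 0 w_neq0.
pose T := starts 0 us.
have T_all k : k \in T by rewrite mem_us.
have sz : size us = p.
  rewrite -(size_starts 0) -(card_uniqP Us) -[RHS](card_Zp_ord p_gt1).
  by apply: eq_card => k; rewrite T_all.
pose W k := flatten (rot (index (- k) T) us).
exists W; split=> [k | S S_T S_gen].
  have := steps_rotate (index (- k) T) (etrans (congr1 _ Dw) w0).
  have Dk : wdeg (flatten (take (index (- k) T) us)) = - k.
    by rewrite -[LHS]add0r -nth_starts ?nth_index // -(size_starts 0) index_mem.
  by rewrite Dk => /(perm_map (shift k)); rewrite Dw map_shiftD subrr map_shift0.
have := Tspace_cyclic S_T S_gen sz (etrans (congr1 _ Dw) w0) Us; congr S.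
pose h (r : 'I_p) : 'Z_p := - nth 0 T r.
have sT : size T = p by rewrite size_starts.
have inj_h : injective h.
  by move=> r s /oppr_inj/eqP; rewrite nth_uniq ?sT // => /eqP/val_inj.
rewrite [RHS](reindex h); last first.
  by apply: onW_bij; apply: inj_card_bij inj_h _; rewrite card_Zp_ord // card_ord.
apply: eq_bigr => r _; rewrite /W /h opprK index_uniq //.
by rewrite sT.
Qed.

End CyclicPolynomials.

(** * Evaluation at graded matrices *)

Section MatrixEvaluation.
Variables (K : idomainType) (n : nat).
Notation p := n.+2.
Notation word := (seq (gvar p)).
Notation edge := ('Z_p * gvar p)%type.
Notation F := (freealg K p).
Notation mon := (@mon K p).
Implicit Types (a : gvar p -> 'M[K]_p) (f g : F) (w : word) (i j k : 'Z_p).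

Definition mxeval a : F -> 'M[K]_p := alg_eval a.

Section MxevalMorphism.
Variable a : gvar p -> 'M[K]_p.

HB.instance Definition _ :=
  GRing.isZmodMorphism.Build F 'M[K]_p (mxeval a) (alg_eval_zmod_morphism a).
HB.instance Definition _ :=
  GRing.isMonoidMorphism.Build F 'M[K]_p (mxeval a)
    (alg_eval_monoid_morphism a (@scalerAr _ _)).
HB.instance Definition _ :=
  GRing.isScalable.Build K F 'M[K]_p *:%R (mxeval a) (alg_eval_scalable a).

End MxevalMorphism.

Lemma evalmxE a f : evalmx a f = mxeval a f.
Proof. by []. Qed.

Lemma mxevalE a f : mxeval a f = \sum_(m <- msupp f) f@_m *: mxeval a (mon m).
Proof. by apply: eq_bigr => m _; rewrite /mxeval alg_eval_mon. Qed.

Definition graded_valuation a := forall x, mxcomp (alpha x) (a x).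

Lemma mxcompP i (b : 'M[K]_p) :
  mxcomp i b <-> forall j k, k != j + i -> b j k = 0.
Proof.
split=> b0 j k.
  by move=> kji; apply: b0; rewrite !natr_Zp subr_eq addrC.
by rewrite !natr_Zp subr_eq addrC; exact: b0.
Qed.

Definition edgeval a (e : edge) : K := a e.2 e.1 (e.1 + alpha e.2).

Lemma mxeval_mon a w i j : graded_valuation a ->
  mxeval a (mon w) i j =
    if j == i + wdeg w then \prod_(e <- steps i w) edgeval a e else 0.
Proof.
move=> a_gr; rewrite [mxeval _ _]alg_eval_mon.
elim: w i j => [|x w IH] i j.
  by rewrite wdeg_nil addr0 !big_nil mxE eq_sym; case: eqP.
rewrite big_cons mxE (bigD1 (i + alpha x)) //= [X in _ + X]big1 => [|k ki].
  by rewrite addr0 IH wdeg_cons addrA big_cons; case: eqP => //; rewrite mulr0.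
by have /mxcompP -> := a_gr x; rewrite ?mul0r.
Qed.

Lemma mxeval_entry a f i j : graded_valuation a ->
  mxeval a f i j =
    \sum_(m <- msupp f | j == i + wdeg m) f@_m * \prod_(e <- steps i m) edgeval a e.
Proof.
move=> a_gr; rewrite mxevalE summxE [RHS]big_mkcond; apply: eq_bigr => m _.
by rewrite mxE mxeval_mon //; case: eqP => //; rewrite mulr0.
Qed.

Lemma mxeval_homogeneous a f i :
  graded_valuation a -> homogeneous i f -> mxcomp i (mxeval a f).
Proof.
move=> a_gr hf; apply/mxcompP => j k kji; rewrite mxeval_entry // big_seq_cond.
by rewrite big1 // => m /andP [/hf dm]; rewrite -[wdeg m]/(mondeg m) dm (negPf kji).
Qed.

Lemma mxcenterP (c : 'M[K]_p) : mxcenter c <-> exists d, c = d%:M.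
Proof.
split=> [c_central | [d ->] b]; last by rewrite scalar_mxC.
have E i j k l : c k i * (l == j)%:R = (k == i)%:R * c j l.
  have /matrixP/(_ k l) := c_central (delta_mx i j).
  rewrite !mxE (bigD1 i) //= [X in _ + X]big1 => [|h hi]; last first.
    by rewrite mxE (negPf hi) mulr0.
  rewrite mxE eqxx addr0 (bigD1 j) //= [X in _ + X]big1 => [|h hj]; last first.
    by rewrite mxE (negPf hj) andbF mul0r.
  by rewrite mxE eqxx andbT addr0.
exists (c 0 0); apply/matrixP => i j; rewrite mxE.
have := E 0 j 0 i; have := E j j i j; rewrite !eqxx mulr1.
case: eqP => [-> _ | _ ->] /=; last by rewrite mul0r.
by rewrite mulr1n mulr1 mul1r => ->.
Qed.

Lemma mxcenterM (c d : 'M[K]_p) : mxcenter c -> mxcenter d -> mxcenter (c * d).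
Proof.
move=> /mxcenterP [x ->] /mxcenterP [y ->]; apply/mxcenterP; exists (x * y).
by rewrite scalar_mxM.
Qed.

End MatrixEvaluation.

(** * Graded central polynomials form a T-space *)

Section Soundness.
Variables (K : idomainType) (n : nat).
Notation p := n.+2.
Notation word := (seq (gvar p)).
Notation edge := ('Z_p * gvar p)%type.
Notation F := (freealg K p).
Notation mon := (@mon K p).
Implicit Types (a : gvar p -> 'M[K]_p) (f g : F) (w : word) (i j k : 'Z_p).

Lemma graded0 : graded_valuation (fun=> 0 : 'M[K]_p).
Proof. by move=> x i j _; rewrite mxE. Qed.

Lemma mcoeff_one f : f@_mone = \sum_(m <- msupp f | m == mone) f@_m.
Proof.
rewrite [f in LHS]monalgE raddf_sum [RHS]big_mkcond; apply: eq_bigr => m _.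
by rewrite /= mcoeffU; case: eqP.
Qed.

Lemma mxeval0 f : mxeval (fun=> 0) f = (f@_mone)%:M.
Proof.
rewrite mxevalE mcoeff_one raddf_sum [RHS]big_mkcond; apply: eq_bigr => m _.
rewrite [mxeval _ _]alg_eval_mon; case: eqP => [-> | m_neq1].
  by rewrite fm1 big_nil; exact: scalemx1.
case: m m_neq1 => -[|x w] /= m_neq1; first by case: m_neq1; rewrite fmonom1.
by rewrite big_cons mul0r scaler0.
Qed.

Lemma mxeval0_eq0 f : mxeval (fun=> 0) f = 0 <-> f@_mone = 0.
Proof.
rewrite mxeval0; split=> [/matrixP/(_ 0 0) | ->]; last by rewrite raddf0.
by rewrite !mxE eqxx.
Qed.

Lemma eq_mxeval a b f : a =1 b -> mxeval a f = mxeval b f.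
Proof.
by move=> eq_ab; apply: eq_bigr => m _; congr (_ *: _); exact: eq_bigr.
Qed.

Lemma mxeval_endo a (phi : {lrmorphism F -> F}) f :
  mxeval a (phi f) = mxeval (fun x => mxeval a (phi (var K x))) f.
Proof.
rewrite [in LHS](freealgE f) !linear_sum mxevalE; apply: eq_bigr => m _.
rewrite !linearZ /=; congr (_ *: _).
rewrite [RHS]alg_eval_mon mon_prod !rmorph_prod; exact: eq_bigr.
Qed.

(** Evaluate at the matrices [c x *: D] with [D] the matrix unit at [(0, 0)]. As
    [f] has no constant term, its value is [v *: D], where [v] is the value of
    [f] at the scalars [c x]; this is a scalar matrix only if [v = 0]. *)
Lemma graded_central_scalar f (c : gvar p -> K) : graded_central f ->
  (forall x, alpha x != 0 -> c x = 0) -> mxeval (fun x => (c x)%:M) f = 0.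
Proof.
move=> [/mxeval0_eq0 f1 f_central] c0.
pose D : 'M[K]_p := delta_mx 0 0.
pose v := \sum_(m <- msupp f) f@_m * \prod_(x <- m) c x.
have DD : D * D = D by exact: mul_delta_mx.
have -> : mxeval (fun x => (c x)%:M) f = v%:M.
  rewrite raddf_sum mxevalE; apply: eq_bigr => m _.
  by rewrite [mxeval _ _]alg_eval_mon -rmorph_prod /= scale_scalar_mx.
have : mxeval (fun x => c x *: D) f = v *: D.
  rewrite scaler_suml; apply: eq_big_seq => m mf.
  rewrite -scalerA; congr (_ *: _); case: m mf => -[|x w] /= mf.
    by move: mf; rewrite -fmonom1 -mcoeff_neq0 f1 eqxx.
  elim: w x {mf} => [|y w IH] x; first by rewrite !big_seq1.
  by rewrite big_cons IH -scalerAl -scalerAr DD scalerA [in RHS]big_cons.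
have /f_central : forall x, mxcomp (alpha x) (c x *: D).
  move=> x; apply/mxcompP => j k kj; rewrite !mxE.
  have [x0 | /c0 ->] := eqVneq (alpha x) 0; last by rewrite mul0r.
  move: kj; rewrite x0 addr0 => kj.
  by case: (eqVneq j 0) kj => [-> /negPf -> | _ _]; rewrite mulr0.
rewrite evalmxE => /mxcenterP [d ->] /matrixP E.
have := E 0 0; have := E 1 1; rewrite !mxE !eqxx /= mulr0 mulr1 => d0 d1.
by apply/matrixP => i j; rewrite !mxE -d1 mulr1n in d0 *; rewrite d0 mul0rn.
Qed.

Lemma mxeval_hcomp a f k i j : graded_valuation a ->
  mxeval a (hcomp k f) i j = if j == i + k then mxeval a f i j else 0.
Proof.
move=> a_gr; rewrite raddf_sum summxE.
have E (m : {fmonom gvar p}) : mondeg m = k -> mxeval a << f@_m *g m >> i j =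
    if j == i + k then f@_m * \prod_(e <- steps i m) edgeval a e else 0.
  move=> Dk; rewrite malgU_scale linearZ mxE mxeval_mon // -[wdeg m]/(mondeg m) Dk.
  by case: eqP; rewrite ?mulr0.
have [Dj | jk] := eqVneq j (i + k); last first.
  by rewrite big1 // => m /eqP /E ->; rewrite (negPf jk).
rewrite mxeval_entry //.
apply: eq_big => [m | m /eqP /E ->]; last by rewrite Dj eqxx.
by rewrite Dj (inj_eq (addrI i)) eq_sym.
Qed.

Lemma graded_valuation_endo a (phi : {lrmorphism F -> F}) :
    graded_valuation a -> graded_endo phi ->
  graded_valuation (fun x => mxeval a (phi (var K x))).
Proof.
move=> a_gr phi_gr x; apply: mxeval_homogeneous => //; apply: phi_gr.
by rewrite var_mon -wdeg_seq1; exact: homogeneous_mon.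
Qed.

Lemma graded_central_Tspace : Tspace (@graded_central K p).
Proof.
split; first split.
- split=> [|a _]; rewrite evalmxE raddf0 //.
  by apply/mxcenterP; exists 0; rewrite raddf0.
- move=> f g [f0 fc] [g0 gc]; split=> [|a a_gr]; rewrite evalmxE raddfD /=.
    by rewrite -!evalmxE f0 g0 addr0.
  have /mxcenterP [x Dx] := fc a a_gr; have /mxcenterP [y Dy] := gc a a_gr.
  by apply/mxcenterP; exists (x + y); rewrite -!evalmxE Dx Dy raddfD.
- move=> c f [f0 fc]; split=> [|a a_gr]; rewrite evalmxE linearZ /=.
    by rewrite -evalmxE f0 scaler0.
  have /mxcenterP [x Dx] := fc a a_gr.
  by apply/mxcenterP; exists (c * x); rewrite -evalmxE Dx scale_scalar_mx.
- move=> g f [f0 fc]; split=> [|a a_gr]; rewrite evalmxE.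
    apply/matrixP => i j; rewrite mxeval_hcomp; last exact: graded0.
    by rewrite -evalmxE f0 !mxE if_same.
  have /mxcenterP [x Dx] := fc a a_gr; rewrite evalmxE in Dx.
  apply/mxcenterP; exists (if g == 0 then x else 0); apply/matrixP => i j.
  rewrite mxeval_hcomp // Dx !mxE; have [-> | g_neq0] := eqVneq g 0.
    by rewrite addr0 eq_sym; case: eqP.
  rewrite mul0rn; case: eqP => // ->.
  by rewrite -[X in X == _]addr0 (inj_eq (addrI _)) eq_sym (negPf g_neq0).
move=> phi phi_gr f f_central; split=> [|a a_gr]; rewrite evalmxE mxeval_endo.
  pose c x := (phi (var K x))@_mone.
  rewrite -[RHS](graded_central_scalar (c := c) f_central) => [|x x_neq0].
    by apply: eq_mxeval => x; exact: mxeval0.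
  have hx : homogeneous (alpha x) (phi (var K x)).
    by apply: phi_gr; rewrite var_mon -wdeg_seq1; exact: homogeneous_mon.
  move/homogeneousE: hx; apply.
  by rewrite fmonom1 /mondeg big_nil eq_sym.
by apply: (proj2 f_central); exact: graded_valuation_endo.
Qed.

End Soundness.

(** A matrix of degree 1 is antidiagonal when the size is 2. *)
Lemma mxcomp1_square (K : idomainType) n (b : 'M[K]_n.+2) :
  n.+2 = 2 -> mxcomp 1 b -> exists d, b ^+ 2 = d%:M.
Proof.
case: n b => // b _ /mxcompP b0; exists (b 0 1 * b 1 0).
have two : 1 + 1 = 0 :> 'Z_2 by exact: val_inj.
apply/matrixP => i j.
rewrite [LHS]mxE (bigD1 (i + 1 : 'Z_2)) //= big1 => [|k ki]; last first.
  by rewrite b0 ?mul0r.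
rewrite addr0 [RHS]mxE; have [<- | ij] := eqVneq i j; last first.
  by rewrite (b0 _ j) ?mulr0 // -addrA two addr0 eq_sym.
have [-> | ->] : i = 0 \/ i = 1.
- by case: i => -[|[|]] // lt_i; [left | right]; exact: val_inj.
- by rewrite add0r mulr1n.
by rewrite two mulrC mulr1n.
Qed.

(** * The generators are graded central *)

Section SoundGenerators.
Variables (K : idomainType) (n : nat).
Notation p := n.+2.
Hypothesis p_prime : prime p.
Notation word := (seq (gvar p)).
Notation F := (freealg K p).
Notation mon := (@mon K p).
Implicit Types (a : gvar p -> 'M[K]_p) (f g : F) (w : word) (i j k : 'Z_p).

Lemma mxeval0_mon w : w != [::] -> mxeval (fun=> 0) (mon w) = 0.
Proof.
by case: w => // x w _; rewrite [mxeval _ _]alg_eval_mon big_cons mul0r.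
Qed.

Lemma eq_mxeval_mon a w w' : graded_valuation a ->
    (forall i, perm_eq (steps i w) (steps i w')) ->
  mxeval a (mon w) = mxeval a (mon w').
Proof.
move=> a_gr ww'; apply/matrixP => i j.
apply: etrans (mxeval_mon w i j a_gr) _; apply/esym.
apply: etrans (mxeval_mon w' i j a_gr) _; apply/esym.
by rewrite (perm_wdeg (perm_steps_letters (ww' i))) (perm_big _ (ww' i)).
Qed.

Lemma mon_cons x w : mon (x :: w) = var K x * mon w.
Proof. by rewrite -cat1s mon_cat var_mon. Qed.

Lemma mon4 x1 x2 x3 x4 :
  mon [:: x1; x2; x3; x4] = var K x1 * (var K x2 * (var K x3 * var K x4)).
Proof. by rewrite (mon_cons x1) (mon_cons x2) (mon_cons x3) -var_mon. Qed.

Lemma mon5 x1 x2 x3 x4 x5 : mon [:: x1; x2; x3; x4; x5] =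
  var K x1 * (var K x2 * (var K x3 * (var K x4 * var K x5))).
Proof. by rewrite (mon_cons x1) mon4. Qed.

Lemma graded_central_mon_sub w w' : w != [::] -> w' != [::] ->
    (forall i, perm_eq (steps i w) (steps i w')) ->
  graded_central (mon w - mon w').
Proof.
move=> w_neq0 w'_neq0 ww'; split=> [|a a_gr]; rewrite evalmxE raddfB /=.
  by rewrite !mxeval0_mon ?subrr.
rewrite (eq_mxeval_mon a_gr ww') subrr.
by apply/mxcenterP; exists 0; rewrite raddf0.
Qed.

Lemma gen_comm_central f : gen_comm f -> graded_central f.
Proof.
case=> [z1 [z2 [x1 [x2 [d1 d2 ->]]]]].
have -> : var K z1 * (var K x1 * var K x2 - var K x2 * var K x1) * var K z2 =
    mon [:: z1; x1; x2; z2] - mon [:: z1; x2; x1; z2].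
  rewrite !mon4.
  exact: (rmorph_commutator (phi := idfun)).
apply: graded_central_mon_sub => // i /=; rewrite d1 d2 !addr0.
rewrite perm_cons.
exact/permPl/(perm_catCA [:: _] [:: _]).
Qed.

Lemma gen_swap_central f : gen_swap f -> graded_central f.
Proof.
case=> [z1 [z2 [x1 [x2 [x3 [d12 d23 _ ->]]]]]].
have -> : var K z1 * (var K x1 * var K x2 * var K x3
                        - var K x3 * var K x2 * var K x1) * var K z2 =
    mon [:: z1; x1; x2; x3; z2] - mon [:: z1; x3; x2; x1; z2].
  rewrite !mon5.
  exact: (rmorph_reversal (phi := idfun)).
apply: graded_central_mon_sub => // i; rewrite /= perm_cons.
have := @perm_steps_swap p (i + alpha z1) [:: x1] [:: x2] [:: x3] [:: z2].
by rewrite !wdeg_seq1 /=; apply; rewrite // d12.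
Qed.

(** The diagonal entries of the value of a closed word are the products over its
    steps from the various vertices. *)
Lemma graded_central_invariant w : w != [::] -> wdeg w = 0 ->
    (forall i, perm_eq (steps i w) (steps 0 w)) ->
  graded_central (mon w).
Proof.
move=> w_neq0 w0 inv; split=> [|a a_gr]; rewrite evalmxE ?mxeval0_mon //.
apply/mxcenterP; exists (\prod_(e <- steps 0 w) edgeval a e).
apply/matrixP => i j; rewrite mxeval_mon // w0 addr0 !mxE eq_sym.
by rewrite (perm_big _ (inv i)); case: eqP.
Qed.

Lemma mon_nseq m w : mon (flatten (nseq m w)) = mon w ^+ m.
Proof. by rewrite mon_flatten big_nseq -Monoid.iteropE. Qed.

Lemma graded_central_var_power (x : gvar p) :
  alpha x != 0 -> graded_central (var K x ^+ p).
Proof.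
move=> dx; rewrite var_mon -mon_nseq; apply: graded_central_invariant => //.
  by rewrite wdeg_nseq Zp_mulrnp.
have dw : wdeg [:: x] != 0 by rewrite wdeg_seq1.
move=> i; rewrite (perm_trans (perm_steps_power p_prime i dw)) // perm_sym.
exact: perm_steps_power.
Qed.

Lemma graded_centralM f g :
  graded_central f -> graded_central g -> graded_central (f * g).
Proof.
move=> [f0 fc] [g0 gc]; split=> [|a a_gr]; rewrite evalmxE rmorphM /=.
  by rewrite -!evalmxE f0 mul0r.
by apply: mxcenterM; [exact: fc | exact: gc].
Qed.

Lemma gen_powp_central f : gen_powp f -> graded_central f.
Proof.
case=> l [x [/andP [l_gt0 _] x_neq0 _ ->]]; case: l l_gt0 x x_neq0 => // l _.
elim: l => [|l IH] x x_neq0; rewrite big_ord_recl.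
  by rewrite big_ord0 mulr1; exact: graded_central_var_power.
apply: graded_centralM; first exact: graded_central_var_power.
exact: IH.
Qed.

Lemma gen_pow2_central f : p = 2 -> gen_pow2 f -> graded_central f.
Proof.
move=> p2 [z1 [z2 [hz1 hz2 Df]]].
have sq (z : F) : homogeneous 1 z -> graded_central (z ^+ 2).
  move=> hz; split=> [|a a_gr]; rewrite evalmxE rmorphXn /=.
    rewrite (_ : mxeval _ z = 0) ?expr0n //; apply/mxeval0_eq0.
    move/homogeneousE: hz; apply.
    by rewrite fmonom1 /mondeg big_nil eq_sym oner_eq0.
  by apply/mxcenterP/mxcomp1_square => //; exact: mxeval_homogeneous.
by case: Df => ->; [exact: sq | apply: graded_centralM; exact: sq].
Qed.

(** The entry [(i, i)] of the value of the [r]-th rotation is the product over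
    the steps of the first word translated by [i - T r], where [T r] is the
    [r]-th partial sum. By completeness this translation takes each value once. *)
Lemma gen_cyclic_central f : gen_cyclic f -> graded_central f.
Proof.
case=> x [/complete_sequenceP [//|sum0 inj_partial] ->].
pose xs := [seq x i | i <- enum 'I_p]; pose us := [seq [:: y] | y <- xs].
have sxs : size xs = p by rewrite size_map -cardE card_ord.
have sus : size us = p by apply: etrans sxs; exact: size_map.
have Dus r : flatten (rot r us) = rot r xs by rewrite -map_rot flatten_seq1.
have Dxs : flatten us = xs by rewrite flatten_seq1.
have nth_xs x0 (i : 'I_p) : nth x0 xs i = x i.
  by rewrite (nth_map i) ?size_enum_ord // nth_ord_enum.
have xs0 : wdeg xs = 0.
  by rewrite /wdeg big_map big_enum.
have -> : \sum_(s in <[full_cycle p]>%g) \prod_(i < p) var K (x (s i)) =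
    \sum_(r < p) mon (rot r xs).
  rewrite sum_full_cycle //; apply: eq_bigr => r _.
  apply/esym; apply: etrans (mon_prod K (rot r xs)) _.
  apply: etrans (esym (prod_full_cycleX (x ord0) (var K) sxs (ltn_ord r))) _.
  by apply: eq_bigr => i _; rewrite nth_xs.
have rot_neq0 r : rot r xs != [::] by rewrite -size_eq0 size_rot sxs.
split=> [|a a_gr]; rewrite evalmxE raddf_sum.
  by rewrite big1 // => r _; exact: mxeval0_mon.
apply/mxcenterP.
pose Q k := \prod_(e <- map (shift k) (steps 0 xs)) edgeval a e.
exists (\sum_k Q k); apply/matrixP => i j; rewrite summxE.
pose T (r : 'I_p) : 'Z_p := \sum_(l < p | (l < r)%N) alpha (x l).
have DT r : T r = wdeg (flatten (take r us)).
  rewrite -(partial_wdeg sus (ltnW (ltn_ord r))).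
  by apply: eq_bigr => l _; rewrite (nth_map (x l)) ?sxs // nth_xs wdeg_seq1.
have inj_h : injective (fun r => i - T r).
  by move=> k l /addrI/oppr_inj/inj_partial.
rewrite [RHS]mxE [X in X *+ _](reindex (fun r => i - T r)) /=; last first.
  by apply: onW_bij; apply: inj_card_bij inj_h _; rewrite !card_ord.
rewrite -sumrMnl; apply: eq_bigr => r _.
apply: etrans (mxeval_mon (rot r xs) i j a_gr) _.
have -> : wdeg (rot r xs) = 0.
  by rewrite -xs0; apply: perm_wdeg; rewrite perm_rot.
rewrite addr0 eq_sym; case: eqP => // _; apply: perm_big.
have := steps_rotate r (etrans (congr1 _ Dxs) xs0).
rewrite Dxs Dus -DT => /(perm_map (@shift p (i - T r))).
by rewrite map_shiftD subrK -steps_from0 perm_sym.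
Qed.

Lemma generators_central f : generators f -> graded_central f.
Proof.
case=> [| | [[p2 H] | [_ H]] |].
- exact: gen_comm_central.
- exact: gen_swap_central.
- exact: gen_pow2_central.
- exact: gen_powp_central.
- exact: gen_cyclic_central.
Qed.

End SoundGenerators.

(** * Polynomial functions on an infinite domain *)

Lemma digits_inj N M (a b : nat -> nat) :
    (forall j, (a j < N)%N) -> (forall j, (b j < N)%N) ->
    (\sum_(j < M) a j * N ^ j = \sum_(j < M) b j * N ^ j)%N ->
  forall j, (j < M)%N -> a j = b j.
Proof.
elim: M a b => // M IH a b aN bN; have N_gt0 := leq_ltn_trans (leq0n _) (aN 0).
have split_low (c : nat -> nat) : (\sum_(j < M.+1) c j * N ^ j =
    (\sum_(j < M) c j.+1 * N ^ j) * N + c 0)%N.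
  rewrite big_ord_recl muln1 addnC big_distrl; congr addn; apply: eq_bigr => j _.
  by rewrite /bump /= expnSr mulnA.
rewrite !split_low => E; have E0 : a 0 = b 0.
  by have := congr1 (modn^~ N) E; rewrite !modnMDl !modn_small.
case=> [|j] // jM; apply: (IH (fun j => a j.+1) (fun j => b j.+1)) => //.
by move/eqP: E; rewrite E0 eqn_add2r eqn_pmul2r // => /eqP.
Qed.

Section Kronecker.
Variables (K : idomainType) (T : countType).
Hypothesis K_infinite : infinite_type K.
Implicit Types (s : seq T) (r : seq (K * seq T)).

(** The exponent of [y] in the monomial of [s] after Kronecker's substitution of
    [y ^+ (N ^ k)] for the [k]-th parameter. In base [N], its digits are the
    multiplicities of the elements of [s]. *)
Definition code N s := (\sum_(e <- s) N ^ choice.pickle e)%N.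

Lemma code_digits N M s : (forall e, e \in s -> choice.pickle e < M)%N ->
  code N s = (\sum_(j < M) count (fun e => choice.pickle e == j) s * N ^ j)%N.
Proof.
elim: s => [|e s IH] sM; first by rewrite [LHS]big_nil big1.
rewrite [LHS]big_cons -[\sum_(_ <- s) _]/(code N s) IH => [|e' e's]; last first.
  by apply: sM; rewrite inE e's orbT.
have eM := sM e (mem_head _ _).
under [RHS]eq_bigr do rewrite mulnDl; rewrite big_split /=; congr addn.
rewrite (bigD1 (Ordinal eM)) //= eqxx mul1n big1 ?addn0 // => j je.
by case: eqP => // Dj; case/eqP: je; apply: val_inj.
Qed.

Lemma code_inj N s1 s2 : (size s1 < N)%N -> (size s2 < N)%N ->
  code N s1 = code N s2 -> perm_eq s1 s2.
Proof.
move=> s1N s2N; pose M := (\max_(e <- s1 ++ s2) choice.pickle e).+1.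
have sM e : e \in s1 ++ s2 -> (choice.pickle e < M)%N.
  by move=> es; rewrite ltnS; exact: leq_bigmax_seq.
have s1M e : e \in s1 -> (choice.pickle e < M)%N.
  by move=> es; apply: sM; rewrite mem_cat es.
have s2M e : e \in s2 -> (choice.pickle e < M)%N.
  by move=> es; apply: sM; rewrite mem_cat es orbT.
rewrite (code_digits N s1M) (code_digits N s2M).
move=> E; apply/allP => e /sM eM; apply/eqP.
have cE s : count_mem e s = count (fun e' => choice.pickle e' == choice.pickle e) s.
  by apply: eq_count => e' /=; rewrite (inj_eq (pcan_inj choice.pickleK)).
pose digit s j := count (fun e' => choice.pickle e' == j) s.
rewrite !cE; apply: (@digits_inj N M (digit s1) (digit s2) _ _ E _ eM) => j.
  exact: leq_ltn_trans (count_size _ _) s1N.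
exact: leq_ltn_trans (count_size _ _) s2N.
Qed.

Lemma infinite_uniq m : exists2 s : seq K, uniq s & size s = m.
Proof.
elim: m => [|m [s Us sz]]; first by exists [::].
by have [x xs] := K_infinite s; exists (x :: s); rewrite /= ?xs ?sz.
Qed.

Lemma poly_vanish (P : {poly K}) : (forall y, P.[y] = 0) -> P = 0.
Proof.
move=> P0; apply/eqP/contraT => P_neq0; have [s Us sz] := infinite_uniq (size P).
have := max_poly_roots P_neq0 _ Us; rewrite sz ltnn; apply.
by apply/allP => y _; apply/eqP.
Qed.

Lemma eval_determines_coef r1 r2 :
    (forall t : T -> K, \sum_(q <- r1) q.1 * \prod_(e <- q.2) t e =
                        \sum_(q <- r2) q.1 * \prod_(e <- q.2) t e) ->
  forall s, \sum_(q <- r1 | perm_eq q.2 s) q.1 = \sum_(q <- r2 | perm_eq q.2 s) q.1.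
Proof.
(* The base exceeds all multiplicities, so that the codes separate multisets. *)
move=> eq_r s; pose N := (size s + \max_(q <- r1 ++ r2) size q.2).+1.
pose P r : {poly K} := \sum_(q <- r) q.1 *: 'X^(code N q.2).
have P_eval r y : (P r).[y] =
    \sum_(q <- r) q.1 * \prod_(e <- q.2) y ^+ (N ^ choice.pickle e).
  rewrite horner_sum; apply: eq_bigr => q _.
  by rewrite hornerZ hornerXn -expr_sum.
have eqP12 : P r1 = P r2.
  apply/eqP; rewrite -subr_eq0; apply/eqP/poly_vanish => y.
  by rewrite hornerD hornerN !P_eval eq_r subrr.
have P_coef r : {subset r <= r1 ++ r2} ->
    (P r)`_(code N s) = \sum_(q <- r | perm_eq q.2 s) q.1.
  move=> sub_r; rewrite coef_sum [RHS]big_mkcond big_seq [RHS]big_seq.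
  apply: eq_bigr => q /sub_r qr; rewrite coefZ coefXn.
  have -> : (code N s == code N q.2) = perm_eq q.2 s; last first.
    by case: ifP; rewrite ?mulr1 ?mulr0.
  apply/eqP/idP => [/esym/code_inj | qs]; last by rewrite /code (perm_big _ qs).
  apply; rewrite ltnS ?leq_addr // (leq_trans _ (leq_addl _ _)) //.
  exact: (@leq_bigmax_seq _ _ xpredT (fun q : K * seq T => size q.2)).
by rewrite -!P_coef ?eqP12 // => q qr; rewrite mem_cat qr ?orbT.
Qed.

End Kronecker.

(** * Class sums of a graded central polynomial *)

Lemma sum_by_classes (V : nmodType) (S : V -> Prop) (I : eqType)
      (e : rel I) (G : I -> V) :
    S 0 -> (forall f g, S f -> S g -> S (f + g)) -> equivalence_rel e ->
  forall r, (forall x, x \in r -> S (\sum_(y <- r | e x y) G y)) ->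
    S (\sum_(y <- r) G y).
Proof.
move=> S0 SD /equivalence_relP [e_refl e_ltrans] r.
have [m] := ubnP (size r); elim: m r => // m IH [|x r] rm classes.
  by rewrite big_nil.
rewrite (bigID (e x)) /=; apply: SD; first by apply: classes; exact: mem_head.
rewrite -big_filter; apply: IH => [|z].
  rewrite /= e_refl /= size_filter; apply: leq_ltn_trans (count_size _ _) _.
  by rewrite -ltnS.
rewrite mem_filter => /andP [xz /classes]; rewrite big_filter_cond; congr S.
apply: eq_bigl => y; case: (boolP (e z y)) => [zy|]; rewrite ?andbF // andbT.
apply/esym/negP => xy; case/negP: xz.
by rewrite (e_ltrans _ _ xy) -(e_ltrans _ _ zy).
Qed.

Section ClassSums.
Variables (K : idomainType) (n : nat).
Notation p := n.+2.
Notation word := (seq (gvar p)).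
Notation edge := ('Z_p * gvar p)%type.
Notation F := (freealg K p).
Notation mon := (@mon K p).
Implicit Types (f g : F) (w : word) (i j k : 'Z_p) (s : seq edge).

Definition class_coef k f i s : K :=
  \sum_(m <- msupp f | (wdeg m == k) && perm_eq (steps i m) s) f@_m.

Definition class_terms k f i : seq (K * seq edge) :=
  [seq (f@_m, steps i (fmonom_val m))
     | m : {fmonom gvar p} <- msupp f & wdeg m == k].

(** Generic graded matrices: the entry of [x] in row [i] is the free parameter
    attached to the step [(i, x)]. *)
Definition edge_valuation (t : edge -> K) (x : gvar p) : 'M[K]_p :=
  \matrix_(i, j) (if j == i + alpha x :> 'Z_p then t (i : 'Z_p, x) else 0).

Lemma edge_valuation_graded t : graded_valuation (edge_valuation t).
Proof. by move=> x; apply/mxcompP => j k kj; rewrite mxE (negPf kj). Qed.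

Lemma edgeval_edge_valuation t e : edgeval (edge_valuation t) e = t e.
Proof. by rewrite /edgeval mxE eqxx; case: e. Qed.

Lemma mxeval_edge_valuation t f i k :
  mxeval (edge_valuation t) f i (i + k) =
    \sum_(q <- class_terms k f i)
      q.1 * \prod_(e <- q.2) t e.
Proof.
rewrite mxeval_entry; last exact: edge_valuation_graded.
rewrite big_map big_filter; apply: eq_big => [m|m _].
  by rewrite (inj_eq (addrI i)) eq_sym.
by congr (_ * _); apply: eq_bigr => e _; exact: edgeval_edge_valuation.
Qed.

Hypothesis K_infinite : infinite_type K.

Lemma class_coefE k f i s :
  class_coef k f i s = \sum_(q <- class_terms k f i | perm_eq q.2 s) q.1.
Proof. by rewrite big_map big_filter_cond. Qed.

(** Off-diagonal entries of a scalar matrix are zero. *)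
Lemma class_coef_degree_neq0 f k s :
  graded_central f -> k != 0 -> class_coef k f 0 s = 0.
Proof.
move=> [_ f_central] k_neq0; rewrite class_coefE.
rewrite (eval_determines_coef (r2 := [::]) K_infinite) ?big_nil // => t.
rewrite big_nil -mxeval_edge_valuation.
have /mxcenterP [d] := f_central _ (edge_valuation_graded t).
rewrite evalmxE => ->; rewrite mxE add0r eq_sym.
by case: eqP => // k0; rewrite k0 eqxx in k_neq0.
Qed.

(** The diagonal entries at [0] and [i] of a scalar matrix agree as polynomials in
    the parameters. *)
Lemma class_coef_shift f i s :
  graded_central f -> class_coef 0 f 0 (map (shift i) s) = class_coef 0 f 0 s.
Proof.
move=> [_ f_central]; transitivity (class_coef 0 f i (map (shift i) s)).
  rewrite !class_coefE; apply: (eval_determines_coef K_infinite) => t.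
  rewrite -!mxeval_edge_valuation !addr0.
  have /mxcenterP [d] := f_central _ (edge_valuation_graded t).
  by rewrite evalmxE => ->; rewrite !mxE !eqxx.
apply: eq_bigl => m; rewrite steps_from0; congr andb.
apply/idP/idP; last exact: perm_map.
move/(perm_map (shift (- i))); by rewrite !map_shiftD addNr !map_shift0.
Qed.

End ClassSums.

(** * Graded central polynomials follow from the generators *)

Section Completeness.
Variables (K : idomainType) (n : nat).
Notation p := n.+2.
Hypotheses (p_prime : prime p) (K_infinite : infinite_type K).
Notation word := (seq (gvar p)).
Notation edge := ('Z_p * gvar p)%type.
Notation F := (freealg K p).
Notation mon := (@mon K p).
Implicit Types (f g : F) (w : word) (i j k : 'Z_p) (s : seq edge).
Variable S : F -> Prop.
Hypotheses (S_T : Tspace S) (S_gen : forall f, generators f -> S f).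

(** All words of a class are congruent to its representative [w]. *)
Lemma class_sum_congr f (P : pred {fmonom gvar p}) w :
  S (\sum_(m <- msupp f | P m && perm_eq (steps 0 m) (steps 0 w)) f@_m *: mon m
     - (\sum_(m <- msupp f | P m && perm_eq (steps 0 m) (steps 0 w)) f@_m)
         *: mon w).
Proof.
rewrite scaler_suml -sumrB; apply: (Tspace_sum S_T) => m _ /andP [_ mw].
rewrite -scalerBr; apply: (TspaceZ S_T).
exact (Tspace_eulerian S_T S_gen mw).
Qed.

Lemma Tspace_congr f g : S (f - g) -> S g -> S f.
Proof. by move=> Sfg Sg; rewrite -[f](subrK g); exact: TspaceD. Qed.

Lemma class_sum_Tspace f k w : S (class_coef k f 0 (steps 0 w) *: mon w) ->
  S (\sum_(m <- msupp f | (wdeg m == k) && perm_eq (steps 0 m) (steps 0 w))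
       f@_m *: mon m).
Proof. by move/(Tspace_congr (class_sum_congr f (fun m => wdeg m == k) w)). Qed.

Lemma class_sum_coef0 f k s : class_coef k f 0 s = 0 ->
  S (\sum_(m <- msupp f | (wdeg m == k) && perm_eq (steps 0 m) s) f@_m *: mon m).
Proof.
move=> c0.
have [/hasP [m _ /andP[_ ms]] | none] :=
    boolP (has (fun m => (wdeg (fmonom_val m) == k)
                           && perm_eq (steps 0 m) s) (msupp f)).
  have E x : perm_eq (steps 0 (fmonom_val x)) s = perm_eq (steps 0 x) (steps 0 m).
    by rewrite (permPr ms).
  under eq_bigl do rewrite E.
  apply: class_sum_Tspace; suff -> : class_coef k f 0 (steps 0 m) = 0.
    by rewrite scale0r; exact: Tspace0.
  by rewrite -c0; apply: eq_bigl => x; rewrite E.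
rewrite big_seq_cond big_pred0; first exact: Tspace0.
by move=> m; case: (boolP (m \in _)) => // /(hasPn none) /negPf.
Qed.

Lemma mon_powers us : mon (powers us) = \prod_(u <- us) mon u ^+ p.
Proof.
rewrite /powers mon_flatten big_map; apply: eq_bigr => u _; exact: mon_nseq.
Qed.

Lemma shift_invariant_Tspace w : w != [::] ->
  perm_eq (steps 0 w) (map (shift 1) (steps 0 w)) -> S (mon w).
Proof.
move=> w_neq0 inv.
have [us [us_ok w_us]] := shift_invariant_powers p_prime w_neq0 inv.
apply: Tspace_congr (Tspace_eulerian S_T S_gen w_us) _.
by rewrite mon_powers; exact: Tspace_pow.
Qed.

Definition shift_equiv (s1 s2 : seq edge) : bool :=
  [exists k : 'Z_p, perm_eq s2 (map (shift k) s1)].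

Lemma perm_shift_move k s1 s2 :
  perm_eq s2 (map (shift k) s1) -> perm_eq s1 (map (shift (- k)) s2).
Proof.
by move/(perm_map (shift (- k))); rewrite map_shiftD addNr map_shift0 perm_sym.
Qed.

Lemma shift_equiv_sym s1 s2 : shift_equiv s1 s2 = shift_equiv s2 s1.
Proof.
by apply/existsP/existsP => -[k /perm_shift_move]; exists (- k).
Qed.

Lemma shift_equiv_trans s1 s2 s3 :
  shift_equiv s1 s2 -> shift_equiv s2 s3 -> shift_equiv s1 s3.
Proof.
move=> /existsP [k s12] /existsP [l s23]; apply/existsP; exists (l + k).
by rewrite (perm_trans s23) // -map_shiftD perm_map.
Qed.

(** This uses that [p] is prime: every nonzero translation generates Z_p. *)
Lemma shift_invariant_generated d s : d != 0 ->
  perm_eq s (map (shift d) s) -> forall k, perm_eq s (map (shift k) s).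
Proof.
move=> d_neq0 inv k.
have : k \in [seq 0 + d *+ m | m <- iota 0 p].
  by rewrite (perm_mem (perm_multiples p_prime 0 d_neq0)) mem_enum.
case/mapP => m _ ->; rewrite add0r; elim: m => [|m IH]; first by rewrite map_shift0.
by rewrite (perm_trans inv) // mulrS -map_shiftD perm_map.
Qed.

Lemma shifts_distinct s : ~~ perm_eq s (map (shift 1) s) ->
  forall k l, perm_eq (map (shift k) s) (map (shift l) s) -> k = l.
Proof.
move=> not_inv k l kl; apply/eqP; apply: contraNT not_inv => k_neq_l.
apply: (@shift_invariant_generated (l - k)); first by rewrite subr_eq0 eq_sym.
move/(perm_map (shift (- k))): kl.
by rewrite !map_shiftD addNr map_shift0 addrC.
Qed.

Lemma sum_shift_classes (V : nmodType) (r : seq {fmonom gvar p})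
      (G : {fmonom gvar p} -> V) s :
    ~~ perm_eq s (map (shift 1) s) ->
  \sum_(m <- r | shift_equiv s (steps 0 m)) G m =
  \sum_k \sum_(m <- r | perm_eq (steps 0 m) (map (shift k) s)) G m.
Proof.
move=> not_inv; rewrite big_mkcond.
under [RHS]eq_bigr do rewrite big_mkcond.
rewrite [RHS]exchange_big /=; apply: eq_bigr => m _.
case: (boolP (shift_equiv _ _)) => [/existsP [k mk] | /existsP no_k]; last first.
  by rewrite big1 // => k _; case: ifP => // mk; case: no_k; exists k.
rewrite -big_mkcond (big_pred1 k) // => l; apply/idP/eqP => [ml | -> //].
by apply: (shifts_distinct not_inv); rewrite -(permPl ml).
Qed.

(** The class translated by [- k] has the same nonzero sum, so it contains a word.
    This word is not empty and its first step, from vertex 0, is the translate of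
    a step from [k]. *)
Lemma visits_all_vertices f w : graded_central f ->
    f@_mone = 0 -> class_coef 0 f 0 (steps 0 w) != 0 ->
  forall k, k \in map fst (steps 0 w).
Proof.
move=> f_central f1 c_neq0 k.
have [/hasP [m mf /andP[_ mk]] | none] :=
    boolP (has (fun m => (wdeg (fmonom_val m) == 0) && perm_eq (steps 0 m)
             (map (shift (- k)) (steps 0 w))) (msupp f)); last first.
  case/eqP: c_neq0; rewrite -(class_coef_shift K_infinite (- k) _ f_central).
  rewrite /class_coef big_seq_cond big_pred0 // => m.
  by case: (boolP (m \in _)) => // /(hasPn none) /negPf.
have : (0 : 'Z_p) \in map fst (steps 0 m).
  case: m mf mk => -[|x v] mf _; last exact: mem_head.
  by move: mf; rewrite -mcoeff_neq0 -fmonom1 f1 eqxx.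
rewrite (perm_mem (perm_map fst mk)) -map_comp => /mapP [e e_w /= Dk].
by apply/mapP; exists e => //; apply: (addrI (- k)); rewrite addNr.
Qed.

Lemma orbit_sum_Tspace f w : graded_central f -> f@_mone = 0 ->
    w != [::] -> wdeg w = 0 ->
  S (\sum_(m <- msupp f | (wdeg m == 0) && shift_equiv (steps 0 w) (steps 0 m))
       f@_m *: mon m).
Proof.
move=> f_central f1 w_neq0 w0.
have [inv | not_inv] := boolP (perm_eq (steps 0 w) (map (shift 1) (steps 0 w))).
  have E m : shift_equiv (steps 0 w) (steps 0 m) = perm_eq (steps 0 m) (steps 0 w).
    apply/existsP/idP => [[k mk] | mw]; last by exists 0; rewrite map_shift0.
    rewrite (perm_trans mk) // perm_sym.
    exact: shift_invariant_generated (oner_neq0 _) inv _.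
  under eq_bigl do rewrite E; apply: class_sum_Tspace.
  by apply: (TspaceZ S_T); exact: shift_invariant_Tspace.
rewrite -big_filter_cond sum_shift_classes //.
under eq_bigr do rewrite big_filter_cond.
have [c0 | c_neq0] := eqVneq (class_coef 0 f 0 (steps 0 w)) 0.
  apply: (Tspace_sum S_T) => k _ _; apply: class_sum_coef0.
  by rewrite class_coef_shift.
(* Each translated class is congruent to the same multiple of its word [W k]. *)
have [W [W_shift W_sum]] := cyclic_shifts K p_prime w_neq0 w0
  (visits_all_vertices f_central f1 c_neq0).
apply: Tspace_congr
  (TspaceZ S_T (class_coef 0 f 0 (steps 0 w)) (W_sum S S_T S_gen)).
rewrite scaler_sumr -sumrB; apply: (Tspace_sum S_T) => k _ _.
have := class_sum_congr f (fun m => wdeg m == 0) (W k).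
rewrite -[X in X *: _]/(class_coef 0 f 0 (steps 0 (W k))).
have -> : class_coef 0 f 0 (steps 0 (W k)) = class_coef 0 f 0 (steps 0 w).
  rewrite -(class_coef_shift K_infinite k (steps 0 w) f_central).
  by apply: eq_bigl => m; rewrite (permPr (W_shift k)).
congr (S (_ - _)); apply: eq_bigl => m.
by rewrite (permPr (W_shift k)).
Qed.

Lemma graded_central_mcoeff_one f : graded_central f -> f@_mone = 0.
Proof. by case=> + _; rewrite evalmxE => /mxeval0_eq0. Qed.

(** In degree zero the words are grouped into orbits under translation, in nonzero
    degree into classes, all of whose sums vanish. *)
Lemma graded_central_in_Tspace f : graded_central f -> S f.
Proof.
move=> f_central; have f1 := graded_central_mcoeff_one f_central.
rewrite (freealgE f) (bigID (fun m : {fmonom gvar p} => wdeg m == 0)) /=.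
have SD := TspaceD S_T; have S0 := Tspace0 S_T.
apply: (TspaceD S_T); rewrite -big_filter.
  apply: (sum_by_classes (e := fun m m' : {fmonom gvar p} =>
                                 shift_equiv (steps 0 m) (steps 0 m'))) => //.
    move=> m m' m''; split=> [|mm'].
      by apply/existsP; exists 0; rewrite map_shift0.
    apply/idP/idP; apply: shift_equiv_trans => //.
    by rewrite shift_equiv_sym.
  move=> m; rewrite mem_filter => /andP [/eqP m0 mf]; rewrite big_filter_cond.
  apply: orbit_sum_Tspace => //; apply: contraTneq mf => m_nil.
  by rewrite -mcoeff_eq0 (_ : m = mone) ?f1 // fmonom1; apply: val_inj.
apply: (sum_by_classes (e := fun m m' : {fmonom gvar p} =>
                               perm_eq (steps 0 m') (steps 0 m))) => //.
  move=> m m' m''; split=> [|mm']; first exact: perm_refl.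
  by rewrite (permPr mm').
move=> m; rewrite mem_filter => /andP [m_neq0 mf]; rewrite big_filter_cond.
have E m' : (wdeg (fmonom_val m') != 0) && perm_eq (steps 0 m') (steps 0 m) =
    (wdeg m' == wdeg m) && perm_eq (steps 0 m') (steps 0 m).
  case: (boolP (perm_eq _ _)) => [mm'|]; rewrite ?andbF // !andbT.
  by rewrite (perm_wdeg (perm_steps_letters mm')) eqxx m_neq0.
under eq_bigl do rewrite E.
by apply: class_sum_coef0; exact: class_coef_degree_neq0.
Qed.

End Completeness.

Theorem theorem8p14 (p : nat) (K : idomainType) (p_prime : prime p)
    (K_infinite : infinite_type K) (f : freealg K p) :
  graded_central f <-> Tspace_generated (@generators K p) f.
Proof.
case: p p_prime f => [|[|n]] // p_prime f; split=> [f_central S S_T S_gen | f_gen].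
  exact: graded_central_in_Tspace.
apply: f_gen; first exact: graded_central_Tspace.
exact: generators_central.
Qed.
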